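(* Let $K\subset S^3$ be a knot and suppose that $K$ has a reflective augmentation of rank at least five. Then there is an element $b\in HC_0^{ab}(K)\otimes\mathbb C$ with $b\notin\sqrt0$ (the nilradical) and $b\in\ker\mathfrak Z$. Consequently the induced map $\mathfrak Z:(HC_0^{ab}(K)\otimes\mathbb C)/\sqrt0\to\mathbb C[X(\Sigma(K))]$ is not an isomorphism.
   Context: Given a diagram $D$ of a knot $K\subset S^3$ with $n\ge1$ crossings, label its $n$ arcs (segments between consecutive undercrossings) by $1,\dots,n$; write $(i,j,k)$ for a crossing whose overcrossing arc is $i$ and whose two undercrossing arcs are $j,k$. The abelian cord ring $HC_0^{ab}(K)$ is the commutative ring $\mathbb Z[c_{ij}: 1\le i<j\le n]/\mathcal I_D$, where $\mathcal I_D$ is generated by all $c_{lj}+c_{lk}-c_{li}c_{ij}$ with $(i,j,k)$ a crossing and $1\le l\le n$, using the conventions $c_{ll}=2$, $c_{ml}=c_{lm}$. Topologically $c_{ij}$ is the class of a cord (a path meeting $K$ exactly in its endpoints, up to homotopy with endpoints moving on $K$ and up to reversal) from arc $i$ to arc $j$ passing above $K$. A reflective augmentation of $K$ is a ring homomorphism $\varepsilon: HC_0^{ab}(K)\to\mathbb C$; its rank is the rank of the $n\times n$ matrix $[\varepsilon(c_{ij})]$ (independent of $D$). $\Sigma(K)$ is the double cover of $S^3$ branched over $K$; $X(\Sigma(K))$ is the $\mathrm{SL}_2\mathbb C$ character variety of $\pi_1(\Sigma(K))$ and $\mathbb C[X(\Sigma(K))]$ its ring of regular functions. The homomorphism $\mathfrak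 Z:HC_0^{ab}(K)\otimes\mathbb C\to\mathbb C[X(\Sigma(K))]$ sends a cord $\gamma$ to the trace function $t_{\tilde\gamma}(\chi)=\chi(\tilde\gamma)$, where $\tilde\gamma\in\pi_1(\Sigma(K))$ (defined up to conjugation and inversion) is the loop formed by the two lifts of $\gamma$ to $\Sigma(K)$. *)

(* Defs.v *)
(* A knot is given up to ambient isotopy by a regular diagram; the double      *)
(* branched cover is any space over the 3-sphere with the usual local models, *)
(* and its fundamental group is built from based loops modulo homotopy.       *)
(* The complex numbers are R[i] for an arbitrary realType R.                  *)

From HB Require Import structures.
From mathcomp Require Import all_boot all_order all_algebra.
From mathcomp Require Import complex ring lra.
From mathcomp Require mpoly.
Import (canonicals) mathcomp.multinomials.mpoly.
From mathcomp Require Import all_classical all_reals all_analysis.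
Import numFieldNormedType.Exports.
Set Implicit Arguments.
Unset Strict Implicit.
Unset Printing Implicit Defensive.
Import Order.TTheory GRing.Theory Num.Theory.
Local Open Scope classical_set_scope.
Local Open Scope quotient_scope.
Local Open Scope ring_scope.

Section WithinCvg.
Variables X Y : topologicalType.

Lemma within_cvgP (A : set X) (g : X -> Y) :
  {within A, continuous g} <-> forall x, A x -> g @ within A (nbhs x) --> g x.
Proof.
split=> [cg x Ax|cg x].
  have := cg x; rewrite /continuous_at /=.
  by rewrite /nbhs /= nbhs_subspace_in.
rewrite /continuous_at; case: (nbhs_subspaceP A x) => [Ax|nAx]; first exact: cg.
by move=> U /= /nbhs_singleton Ux /= _ ->.
Qed.
End WithinCvg.

Section Within.
Variables X Y T : topologicalType.

Lemma within_comp (A : set X) (B : set Y) (f : Y -> T) (phi : X -> Y) :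
  {within A, continuous phi} -> (forall x, A x -> B (phi x)) ->
  {within B, continuous f} -> {within A, continuous (f \o phi)}.
Proof.
move=> /within_cvgP cphi AB /within_cvgP cf; apply/within_cvgP => x Ax.
apply: cvg_trans (cf _ (AB _ Ax)) => U /= fU; rewrite /nbhs /=.
have := cphi x Ax _ fU; rewrite /nbhs/=; rewrite /within /=.
by apply: filterS => z + Az => /(_ Az); apply; exact: AB.
Qed.

Lemma within_paste (A B C : set X) (f f1 f2 : X -> T) :
  closed A -> closed B -> closed C -> A `<=` B `|` C ->
  {within A `&` B, continuous f1} -> {within A `&` C, continuous f2} ->
  {in A `&` B, f1 =1 f} -> {in A `&` C, f2 =1 f} ->
  {within A, continuous f}.
Proof.
move=> cA cB cC ABC c1 c2 e1 e2.
have -> : A = (A `&` B) `|` (A `&` C).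
  by rewrite -setIUr; apply/esym/setIidPl.
apply: withinU_continuous; [exact: closedI|exact: closedI|..].
- exact: (subspace_eq_continuous e1).
- exact: (subspace_eq_continuous e2).
Qed.
End Within.

Lemma continuous_pair (X Y Z : topologicalType) (f : X -> Y) (g : X -> Z) :
  continuous f -> continuous g -> continuous (fun x => (f x, g x)).
Proof. by move=> cf cg x; apply: cvg_pair; [exact: cf|exact: cg]. Qed.

Lemma continuous_affine (R : realType) (X : topologicalType) (a b : R)
    (k : X -> R) : continuous k -> continuous (fun x => a * k x + b).
Proof.
by move=> ck x; apply: cvgD; [apply: cvgM; [exact: cvg_cst|exact: ck]|exact: cvg_cst].
Qed.

Section Paths.
Variable (R : realType) (T : topologicalType).
Implicit Types (f g h : R -> T) (x y z : T).

Definition is_path x y f :=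
  [/\ {within `[0, 1], continuous f}, f 0 = x & f 1 = y].

Definition path_homotopic f g := exists H : R * R -> T,
  [/\ {within `[0, 1] `*` `[0, 1], continuous H},
      forall t, t \in `[0, 1] -> H (0, t) = f t /\ H (1, t) = g t &
      forall s, s \in `[0, 1] -> H (s, 0) = f 0 /\ H (s, 1) = f 1].

Definition path_cat f g t := if t <= 2^-1 then f (2 * t) else g (2 * t - 1).

Definition path_rev f t := f (1 - t).

Local Notation I := (`[0, 1]%classic : set R).
Local Notation I2 := (`[0, 1] `*` `[0, 1] : set (R * R)).

Let cfst : continuous (fun p : R * R => p.1).
Proof. by move=> p; exact: cvg_fst. Qed.

Let csnd : continuous (fun p : R * R => p.2).
Proof. by move=> p; exact: cvg_snd. Qed.

Lemma closed_I2 : closed I2.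
Proof.
apply: (@closedI _ (fst @^-1` I) (snd @^-1` I)).
  by apply: closed_comp => [p _|]; [exact: cfst|exact: interval_closed].
by apply: closed_comp => [p _|]; [exact: csnd|exact: interval_closed].
Qed.

Lemma reparam_homotopic f (phi psi : R -> R) :
  {within I, continuous f} ->
  continuous phi -> continuous psi ->
  (forall t, t \in `[0, 1] -> phi t \in `[0, 1] /\ psi t \in `[0, 1]) ->
  phi 0 = psi 0 -> phi 1 = psi 1 ->
  path_homotopic (f \o phi) (f \o psi).
Proof.
move=> cf cphi cpsi rng e0 e1.
exists (fun p => f ((1 - p.1) * phi p.2 + p.1 * psi p.2)); split.
- apply: (@within_comp _ _ _ I2 I f
    (fun p : R * R => (1 - p.1) * phi p.2 + p.1 * psi p.2)) => //.
    apply: continuous_subspaceT => p.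
    apply: cvgD; apply: cvgM.
    + by apply: cvgB; [exact: cvg_cst|exact: cfst].
    + by apply: continuous_comp; [exact: csnd|exact: cphi].
    + exact: cfst.
    + by apply: continuous_comp; [exact: csnd|exact: cpsi].
  move=> [s t] [/= sI tI]; have [] := rng t tI; move: sI.
  rewrite /= !in_itv/=; nra.
- by move=> t tI /=; rewrite subr0 subrr !mul1r !mul0r addr0 add0r.
- by move=> s sI /=; rewrite -e0 -e1 -!mulrDl subrK !mul1r.
Qed.

Lemma eq_homotopic f g : {within I, continuous f} ->
  (forall t, t \in `[0, 1] -> f t = g t) -> path_homotopic f g.
Proof.
move=> cf fg; exists (fun p => f p.2); split=> [|t tI|s sI] //=.
  apply: (@within_comp _ _ _ I2 I f snd) => //.
    by apply: continuous_subspaceT => p; exact: csnd.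
  by move=> [s t] [].
by rewrite fg.
Qed.

Lemma homotopic_sym f g : path_homotopic f g -> path_homotopic g f.
Proof.
move=> [H [cH Hfg Hs]].
have E0 : (0 : R) \in `[0, 1] by rewrite in_itv/= lexx ler01.
have E1 : (1 : R) \in `[0, 1] by rewrite in_itv/= lexx ler01.
have e0 : f 0 = g 0 by rewrite -(Hfg _ E0).2; case: (Hs _ E1).
have e1 : f 1 = g 1 by rewrite -(Hfg _ E1).2; case: (Hs _ E1).
exists (fun p => H (1 - p.1, p.2)); split=> [|t tI|s sI] /=.
- apply: (@within_comp _ _ _ I2 I2 H (fun p : R * R => (1 - p.1, p.2))) => //.
    apply: continuous_subspaceT; apply: continuous_pair => // p.
    by apply: cvgB; [exact: cvg_cst|exact: cfst].
  by move=> [s t] [/= sI tI]; split=> //=; move: sI; rewrite /= !in_itv/=; lra.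
- by rewrite subr0 subrr; have [] := Hfg _ tI.
- rewrite -e0 -e1; apply: Hs; move: sI; rewrite !in_itv/=; lra.
Qed.

Lemma within_square_comp (A : set (R * R)) (F : R * R -> T) (phi : R * R -> R * R) :
  {within I2, continuous F} -> continuous phi -> (forall p, A p -> I2 (phi p)) ->
  {within A, continuous (F \o phi)}.
Proof.
move=> cF cphi AI; apply: (@within_comp _ _ _ A I2) => //.
exact: continuous_subspaceT.
Qed.

Lemma closed_le_comp (a : R) (k : R * R -> R) : continuous k -> closed [set p | k p <= a].
Proof.
move=> ck; apply: (@closed_comp _ _ k [set z | z <= a]) => [z _|].
  exact: ck.
exact: closed_le.
Qed.

Lemma closed_ge_comp (a : R) (k : R * R -> R) : continuous k -> closed [set p | a <= k p].
Proof.
move=> ck; apply: (@closed_comp _ _ k [set z | a <= z]) => [z _|].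
  exact: ck.
exact: closed_ge.
Qed.

Lemma homotopic_trans f g h :
  path_homotopic f g -> path_homotopic g h -> path_homotopic f h.
Proof.
move=> [F [cF Ffg Fs]] [G [cG Ggh Gs]].
have E0 : (0 : R) \in `[0, 1] by rewrite in_itv/= lexx ler01.
have E1 : (1 : R) \in `[0, 1] by rewrite in_itv/= lexx ler01.
have e0 : f 0 = g 0 by rewrite -(Ffg _ E0).2; case: (Fs _ E1).
have e1 : f 1 = g 1 by rewrite -(Ffg _ E1).2; case: (Fs _ E1).
exists (fun p => if p.1 <= 2^-1 then F (2 * p.1, p.2) else G (2 * p.1 - 1, p.2)).
split=> [|t tI|s sI] /=.
- apply: (@within_paste _ _ I2 [set p | p.1 <= 2^-1] [set p | 2^-1 <= p.1] _
   (F \o (fun p => (2 * p.1, p.2))) (G \o (fun p => (2 * p.1 - 1, p.2)))).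
  + exact: closed_I2.
  + by apply: closed_le_comp => p; exact: cfst.
  + by apply: closed_ge_comp => p; exact: cfst.
  + by move=> p _; apply/orP/le_total.
  + apply: within_square_comp => // [|[s t] [[/= + tI] s2]].
      apply: continuous_pair => // p.
      by apply: cvgM; [exact: cvg_cst|exact: cfst].
    by rewrite /= in_itv/= => sI; split=> //=; rewrite in_itv/=; lra.
  + apply: within_square_comp => // [|[s t] [[/= + tI] s2]].
      apply: continuous_pair => // p.
      apply: cvgB; last exact: cvg_cst.
      by apply: cvgM; [exact: cvg_cst|exact: cfst].
    by rewrite /= in_itv/= => sI; split=> //=; rewrite in_itv/=; lra.
  + by move=> p; rewrite inE => -[_ /= ->].
  + move=> [s t]; rewrite inE => -[[/= sI tI] s2]; case: ifPn => // s2'.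
    have -> : s = 2^-1 by apply/le_anti; rewrite s2' s2.
    by rewrite divff// subrr; have [_ ->] := Ffg _ tI; have [->] := Ggh _ tI.
- rewrite invr_ge0 ler0n mulr0; split; first by have [] := Ffg _ tI.
  have -> : ((1 : R) <= 2^-1) = false by apply/negbTE; rewrite -ltNge; lra.
  by rewrite mulr1 addrK; have [] := Ggh _ tI.
- case: ifPn => s2; first by apply: Fs; move: sI s2; rewrite !in_itv/=; lra.
  by rewrite e0 e1; apply: Gs; move: sI s2; rewrite -ltNge !in_itv/=; lra.
Qed.

Lemma path_cat_homotopic x y z f f' g g' :
  is_path x y f -> is_path y z g ->
  path_homotopic f f' -> path_homotopic g g' ->
  path_homotopic (path_cat f g) (path_cat f' g').
Proof.
move=> [_ f0 f1] [_ g0 g1] [F [cF Ff Fs]] [G [cG Gg Gs]].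
exists (fun p => if p.2 <= 2^-1 then F (p.1, 2 * p.2) else G (p.1, 2 * p.2 - 1)).
split=> [|t tI|s sI] /=.
- apply: (@within_paste _ _ I2 [set p | p.2 <= 2^-1] [set p | 2^-1 <= p.2] _
   (F \o (fun p => (p.1, 2 * p.2))) (G \o (fun p => (p.1, 2 * p.2 - 1)))).
  + exact: closed_I2.
  + by apply: closed_le_comp => p; exact: csnd.
  + by apply: closed_ge_comp => p; exact: csnd.
  + by move=> p _; apply/orP/le_total.
  + apply: within_square_comp => // [|[s t] [[/= sI +] s2]].
      apply: continuous_pair => // p.
      by apply: cvgM; [exact: cvg_cst|exact: csnd].
    by rewrite /= in_itv/= => tI; split=> //=; rewrite in_itv/=; lra.
  + apply: within_square_comp => // [|[s t] [[/= sI +] s2]].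
      apply: continuous_pair => // p.
      apply: cvgB; last exact: cvg_cst.
      by apply: cvgM; [exact: cvg_cst|exact: csnd].
    by rewrite /= in_itv/= => tI; split=> //=; rewrite in_itv/=; lra.
  + by move=> p; rewrite inE => -[_ /= ->].
  + move=> [s t]; rewrite inE => -[[/= sI tI] s2]; case: ifPn => // s2'.
    have -> : t = 2^-1 by apply/le_anti; rewrite s2' s2.
    by rewrite divff// subrr; have [_ ->] := Fs _ sI; have [->] := Gs _ sI; rewrite f1 g0.
- rewrite /path_cat; case: ifPn => t2.
    by apply: Ff; move: tI t2; rewrite !in_itv/=; lra.
  by apply: Gg; move: tI t2; rewrite -ltNge !in_itv/=; lra.
- rewrite /path_cat invr_ge0 ler0n mulr0.
  have -> : ((1 : R) <= 2^-1) = false by apply/negbTE; rewrite -ltNge; lra.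
  by rewrite mulr1 addrK; have [-> _] := Fs _ sI; have [_ ->] := Gs _ sI.
Qed.

Lemma path_rev_homotopic f f' :
  path_homotopic f f' -> path_homotopic (path_rev f) (path_rev f').
Proof.
move=> [F [cF Ff Fs]]; exists (fun p => F (p.1, 1 - p.2)).
split=> [|t tI|s sI] /=.
- apply: (@within_comp _ _ _ I2 I2 F (fun p : R * R => (p.1, 1 - p.2))) => //.
    apply: continuous_subspaceT; apply: continuous_pair => // p.
    by apply: cvgB; [exact: cvg_cst|exact: csnd].
  by move=> [s t] [/= sI tI]; split=> //=; move: tI; rewrite /= !in_itv/=; lra.
- by apply: Ff; move: tI; rewrite !in_itv/=; lra.
- by rewrite /path_rev subr0 subrr; have [-> ->] := Fs _ sI.
Qed.

Lemma is_path_cst x : is_path x x (cst x).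
Proof. by split=> //; apply: continuous_subspaceT => t; exact: cvg_cst. Qed.

Lemma is_path_rev x y f : is_path x y f -> is_path y x (path_rev f).
Proof.
move=> [cf f0 f1]; split; rewrite /path_rev ?subr0 ?subrr//.
apply: (@within_comp _ _ _ I I f (fun t : R => 1 - t)) => //.
  by apply: continuous_subspaceT => t; apply: cvgB; [exact: cvg_cst|exact: cvg_id].
by move=> t; rewrite /= !in_itv/=; lra.
Qed.

Lemma is_path_cat x y z f g :
  is_path x y f -> is_path y z g -> is_path x z (path_cat f g).
Proof.
move=> [cf f0 f1] [cg g0 g1]; split; last 2 first.
- by rewrite /path_cat invr_ge0 ler0n mulr0.
- rewrite /path_cat; have -> : ((1 : R) <= 2^-1) = false by apply/negbTE; rewrite -ltNge; lra.
  by rewrite mulr1 addrK.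
apply: (@within_paste _ _ I [set t | t <= 2^-1] [set t | 2^-1 <= t] _
   (f \o (fun t => 2 * t)) (g \o (fun t => 2 * t - 1))).
- exact: interval_closed.
- exact: closed_le.
- exact: closed_ge.
- by move=> p _; apply/orP/le_total.
- apply: (@within_comp _ _ _ _ I) => // [|t].
    by apply: continuous_subspaceT => t; apply: cvgM; [exact: cvg_cst|exact: cvg_id].
  by move=> []; rewrite /= !in_itv/=; lra.
- apply: (@within_comp _ _ _ _ I) => // [|t].
    apply: continuous_subspaceT => t; apply: cvgB; last exact: cvg_cst.
    by apply: cvgM; [exact: cvg_cst|exact: cvg_id].
  by move=> []; rewrite /= !in_itv/=; lra.
- by move=> t; rewrite inE /path_cat => -[_ /= ->].
- move=> t; rewrite inE /path_cat => -[/= tI t2]; case: ifPn => // t2'.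
  have -> : t = 2^-1 by apply/le_anti; rewrite t2' t2.
  by rewrite divff// subrr f1 g0.
Qed.

End Paths.

Section FundamentalGroup.
Variable (R : realType) (T : topologicalType) (x0 : T).

Record loop := Loop { loop_fun :> R -> T; loopP : is_path x0 x0 loop_fun }.

HB.instance Definition _ := gen_eqMixin loop.
HB.instance Definition _ := gen_choiceMixin loop.

Definition loop_equiv (f g : loop) := `[< path_homotopic f g >].

Lemma loop_equiv_class : equiv_class_of loop_equiv.
Proof.
split=> [f|f g|g f h].
- by apply/asboolP/eq_homotopic => //; case: (loopP f).
- by apply/asboolP/asboolP => /homotopic_sym.
- by move=> /asboolP fg /asboolP gh; apply/asboolP/(homotopic_trans fg gh).
Qed.

Canonical loop_equiv_equiv := EquivRelPack loop_equiv_class.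

Definition pi1 := {eq_quot loop_equiv}.
HB.instance Definition _ := EqQuotient.on pi1.
HB.instance Definition _ := Choice.on pi1.

Definition pi1_class (f : loop) : pi1 := \pi_pi1 f.

Definition loop_cst := Loop (is_path_cst R x0).
Definition loop_cat (f g : loop) := Loop (is_path_cat (loopP f) (loopP g)).
Definition loop_rev (f : loop) := Loop (is_path_rev (loopP f)).

Definition pi1_one : pi1 := pi1_class loop_cst.
Definition pi1_mul (a b : pi1) : pi1 := pi1_class (loop_cat (repr a) (repr b)).
Definition pi1_inv (a : pi1) : pi1 := pi1_class (loop_rev (repr a)).

Lemma pi1_classP (f g : loop) : pi1_class f = pi1_class g <-> path_homotopic f g.
Proof. by split=> [/eqmodP/asboolP//|fg]; apply/eqmodP/asboolP. Qed.

Lemma pi1_class_repr f : path_homotopic (repr (pi1_class f)) f.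
Proof. by apply/pi1_classP; rewrite /pi1_class reprK. Qed.

Lemma pi1_classM f g :
  pi1_mul (pi1_class f) (pi1_class g) = pi1_class (loop_cat f g).
Proof.
apply/pi1_classP.
exact: (path_cat_homotopic (loopP _) (loopP _) (pi1_class_repr f) (pi1_class_repr g)).
Qed.

Lemma pi1_classV f : pi1_inv (pi1_class f) = pi1_class (loop_rev f).
Proof. exact/pi1_classP/path_rev_homotopic/pi1_class_repr. Qed.

Lemma pi1_ind (P : pi1 -> Prop) : (forall f, P (pi1_class f)) -> forall a, P a.
Proof. by move=> Pf a; rewrite -[a]reprK; exact: Pf. Qed.

Lemma loop_reparam (f g h : loop) (phi psi : R -> R) :
  continuous phi -> continuous psi ->
  (forall t : R, 0 <= t <= 1 -> 0 <= phi t <= 1 /\ 0 <= psi t <= 1) ->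
  phi 0 = psi 0 -> phi 1 = psi 1 ->
  (forall t : R, 0 <= t <= 1 -> f (phi t) = g t) ->
  (forall t : R, 0 <= t <= 1 -> f (psi t) = h t) ->
  pi1_class g = pi1_class h.
Proof.
move=> cphi cpsi rng e0 e1 fg fh; apply/pi1_classP.
have [cf _ _] := loopP f; have [cg _ _] := loopP g; have [ch _ _] := loopP h.
apply: (@homotopic_trans _ _ _ (f \o phi)).
  by apply: eq_homotopic => // t /itvP tI; rewrite -fg//= !tI.
apply: (@homotopic_trans _ _ _ (f \o psi)).
  exact: reparam_homotopic.
by apply/homotopic_sym/eq_homotopic => // t /itvP tI; rewrite -fh//= !tI.
Qed.

Let cid : continuous (fun t : R => t). Proof. by move=> t; exact: cvg_id. Qed.
Let caff (a b : R) : continuous (fun t : R => a * t + b).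
Proof. exact: continuous_affine. Qed.
Let cmin (f g : R -> R) : continuous f -> continuous g ->
  continuous (fun t => Num.min (f t) (g t)).
Proof. by move=> cf cg t; apply: continuous_min; [exact: cf|exact: cg]. Qed.
Let cmax (f g : R -> R) : continuous f -> continuous g ->
  continuous (fun t => Num.max (f t) (g t)).
Proof. by move=> cf cg t; apply: continuous_max; [exact: cf|exact: cg]. Qed.

Lemma pi1_mulA : associative pi1_mul.
Proof.
elim/pi1_ind => f; elim/pi1_ind => g; elim/pi1_ind => h.
rewrite !pi1_classM.
apply/esym/(@loop_reparam (loop_cat f (loop_cat g h)) _ _
  (fun t => Num.min (2 * t + 0) (Num.min (1 * t + 4^-1) (2^-1 * t + 2^-1)))
  (fun t => t)) => //.
- by do 2?apply: cmin.
- move=> t tI; split=> //.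
  case: (leP (1 * t + 4^-1) (2^-1 * t + 2^-1)) => ?;
  by case: (leP (2 * t + 0) _) => ?; lra.
- by rewrite !min_l; lra.
- by rewrite !min_r; lra.
- move=> t tI; rewrite /= /path_cat.
  case: (leP (1 * t + 4^-1) (2^-1 * t + 2^-1)) => ?;
  case: (leP (2 * t + 0) _) => ?;
  do ?case: ifPn; rewrite -?ltNge; move=> *;
  by first [exfalso; lra | congr (loop_fun _ _); lra].
Qed.

Lemma pi1_mul1 : left_id pi1_one pi1_mul.
Proof.
elim/pi1_ind => f; rewrite !pi1_classM; have [_ f0 f1] := loopP f.
apply: (@loop_reparam f _ _
  (fun t => Num.max (0 * t + 0) (2 * t + - 1)) (fun t => t)) => //.
- by apply: cmax.
- by move=> t tI; split=> //; rewrite !maxElt; case: ltP => *; clear f0 f1; lra.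
- by rewrite !maxElt; case: ltP => *; clear f0 f1; lra.
- by rewrite !maxElt; case: ltP => *; clear f0 f1; lra.
- move=> t tI; rewrite /= /path_cat !maxElt /cst.
  case: ltP => ?; do ?case: ifPn; rewrite -?ltNge; move=> *;
  by first [clear f0 f1; exfalso; lra | congr (loop_fun _ _); clear f0 f1; lra
    | rewrite -f0; congr (loop_fun _ _); clear f0 f1; lra].
Qed.

Lemma pi1_mulr1 : right_id pi1_one pi1_mul.
Proof.
elim/pi1_ind => f; rewrite !pi1_classM; have [_ f0 f1] := loopP f.
apply: (@loop_reparam f _ _
  (fun t => Num.min (0 * t + 1) (2 * t + 0)) (fun t => t)) => //.
- by apply: cmin.
- by move=> t tI; split=> //; rewrite !minElt; case: ltP => *; clear f0 f1; lra.
- by rewrite !minElt; case: ltP => *; clear f0 f1; lra.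
- by rewrite !minElt; case: ltP => *; clear f0 f1; lra.
- move=> t tI; rewrite /= /path_cat !minElt /cst.
  case: ltP => ?; do ?case: ifPn; rewrite -?ltNge; move=> *;
  by first [clear f0 f1; exfalso; lra | congr (loop_fun _ _); clear f0 f1; lra
    | rewrite -f1; congr (loop_fun _ _); clear f0 f1; lra].
Qed.

Lemma pi1_mulV : left_inverse pi1_one pi1_inv pi1_mul.
Proof.
elim/pi1_ind => f; rewrite !pi1_classV !pi1_classM; have [_ f0 f1] := loopP f.
apply: (@loop_reparam f _ _
  (fun t => Num.max (- 2 * t + 1) (2 * t + - 1)) (fun t => 0 * t + 1)) => //.
- by apply: cmax.
- by move=> t tI; split; [rewrite maxElt; case: ltP => *|]; clear f0 f1; lra.
- by rewrite !maxElt; case: ltP => *; clear f0 f1; lra.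
- by rewrite !maxElt; case: ltP => *; clear f0 f1; lra.
- move=> t tI; rewrite /= /path_cat /path_rev !maxElt /cst.
  case: ltP => ?; do ?case: ifPn; rewrite -?ltNge; move=> *;
  by first [clear f0 f1; exfalso; lra | congr (loop_fun _ _); clear f0 f1; lra
    | rewrite -f0; congr (loop_fun _ _); clear f0 f1; lra].
- by move=> t tI; rewrite mul0r add0r f1.
Qed.

Lemma pi1_mulrV : right_inverse pi1_one pi1_inv pi1_mul.
Proof.
elim/pi1_ind => f; rewrite !pi1_classV !pi1_classM; have [_ f0 f1] := loopP f.
apply: (@loop_reparam f _ _
  (fun t => Num.min (- 2 * t + 2) (2 * t + 0)) (fun t => 0 * t + 0)) => //.
- by apply: cmin.
- by move=> t tI; split; [rewrite minElt; case: ltP => *|]; clear f0 f1; lra.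
- by rewrite !minElt; case: ltP => *; clear f0 f1; lra.
- by rewrite !minElt; case: ltP => *; clear f0 f1; lra.
- move=> t tI; rewrite /= /path_cat /path_rev !minElt /cst.
  case: ltP => ?; do ?case: ifPn; rewrite -?ltNge; move=> *;
  by first [clear f0 f1; exfalso; lra | congr (loop_fun _ _); clear f0 f1; lra
    | rewrite -f0; congr (loop_fun _ _); clear f0 f1; lra].
- by move=> t tI; rewrite mul0r add0r f0.
Qed.

HB.instance Definition _ := isGroup.Build pi1
  pi1_mulA pi1_mul1 pi1_mulr1 pi1_mulV pi1_mulrV.

End FundamentalGroup.

Section GeneratedIdeal.
Variables (A : comNzRingType) (gens : set A).

Definition ideal_gen : {pred A} := fun a => `[<
  exists (k : nat) (c r : 'I_k -> A),
    (forall i, gens (r i)) /\ a = \sum_(i < k) c i * r i >].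

Lemma ideal_gen_closed : 1 \notin ideal_gen -> idealr_closed ideal_gen.
Proof.
move=> n1; split=> //.
  apply/asboolP; exists 0%N, (fun=> 0), (fun=> 0).
  by split=> [[]//|]; rewrite big_ord0.
move=> a _ _ /asboolP[k [c [r [gr ->]]]] /asboolP[l [d [s [gs ->]]]].
apply/asboolP; exists (k + l)%N.
exists (fun i => match fintype.split i with inl j => a * c j | inr j => d j end).
exists (fun i => match fintype.split i with inl j => r j | inr j => s j end).
split=> [i|]; first by case: (fintype.split i).
rewrite big_split_ord mulr_sumr /=; congr (_ + _); apply: eq_bigr => i _.
  by case: split_ordP => j /eqP; rewrite ?eq_lshift ?eq_lrshift// => /eqP ->; rewrite mulrA.
by case: split_ordP => j /eqP; rewrite ?eq_rshift ?eq_rlshift// => /eqP ->.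
Qed.

End GeneratedIdeal.

Section Nilradical.
Variable A : comNzRingType.

Definition nilradical : {pred A} := fun a => `[< exists k : nat, a ^+ k = 0 >].

Lemma nilradical_closed : idealr_closed nilradical.
Proof.
split.
- by apply/asboolP; exists 1%N; rewrite expr1.
- by apply/negP => /asboolP[k]; rewrite expr1n => /eqP; rewrite oner_eq0.
move=> a x y /asboolP[k xk] /asboolP[l yl]; apply/asboolP; exists (k + l)%N.
rewrite exprDn big1// => i _; case: (leqP l i) => li.
  by rewrite -(subnK li) exprD yl !mulr0 mul0rn.
have /subnK <- : (k <= k + l - i)%N by rewrite -addnBA ?leq_addr // ltnW.
by rewrite exprD [(a * x) ^+ k]exprMn xk !mulr0 mul0r mul0rn.
Qed.

HB.instance Definition _ := isIdealr.Build A nilradical nilradical_closed.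

End Nilradical.

Section Diagram.
Variable R : realType.
Implicit Types (s t : R) (c : R -> R * R * R).

Definition S3 : topologicalType := one_point_compactification (R * R * R)%type.

Definition xcoord c t := (c t).1.1.
Definition ycoord c t := (c t).1.2.
Definition zcoord c t := (c t).2.

Definition C1 (f : R -> R) :=
  (forall t, derivable f t 1) /\ continuous (derive1 f).

Definition eq_mod1 s t := exists k : int, s = t + k%:~R.

(* A 1-periodic C^1 parametrization [dcurve] of an embedded circle in R^3      *)
(* whose projection [(dcurve t).1] to the plane is regular: an immersion with *)
(* finitely many double points, all transverse, and no triple point. At the   *)
(* crossing k the strand at time [dunder k] passes below the one at time      *)
(* [dover k]; crossings are numbered in the order in which the knot passes    *)
(* under them.                                                                *)
Record diagram := Diagram {
  dcurve : R -> R * R * R;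
  dn : nat;
  dunder : 'I_dn -> R;
  dover : 'I_dn -> R;
  dcurve_C1 : [/\ C1 (xcoord dcurve), C1 (ycoord dcurve) & C1 (zcoord dcurve)];
  dcurve_periodic : forall t, dcurve (t + 1) = dcurve t;
  dcurve_inj : forall s t, dcurve s = dcurve t -> eq_mod1 s t;
  dcurve_immersed : forall t,
    (derive1 (xcoord dcurve) t, derive1 (ycoord dcurve) t) <> (0, 0);
  dn_gt0 : (0 < dn)%N;
  dunder_range : forall k, 0 <= dunder k < 1;
  dunder_mono : forall j k : 'I_dn, (j < k)%N -> dunder j < dunder k;
  dcross : forall k, (dcurve (dunder k)).1 = (dcurve (dover k)).1 /\
    zcoord dcurve (dunder k) < zcoord dcurve (dover k);
  ddouble : forall s t, (dcurve s).1 = (dcurve t).1 ->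
    eq_mod1 s t \/ exists k,
      (eq_mod1 s (dunder k) /\ eq_mod1 t (dover k)) \/
      (eq_mod1 s (dover k) /\ eq_mod1 t (dunder k));
  dtriple : forall r s t,
    (dcurve r).1 = (dcurve s).1 -> (dcurve s).1 = (dcurve t).1 ->
    [\/ eq_mod1 r s, eq_mod1 s t | eq_mod1 r t];
  dtransverse : forall k,
    derive1 (xcoord dcurve) (dunder k) * derive1 (ycoord dcurve) (dover k) !=
    derive1 (xcoord dcurve) (dover k) * derive1 (ycoord dcurve) (dunder k)
}.

Variable D : diagram.

(* The arc i runs from the undercrossing i to the next one, cyclically. *)
Definition knot_arc (i : 'I_(dn D)) t := exists k : int,
  dunder i < t + k%:~R < dunder (ordS i) + (i.+1 == dn D)%:R.

Definition crossing (i j k : 'I_(dn D)) := exists m : 'I_(dn D),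
  knot_arc i (dover m) /\
  ((j, k) = (ord_pred m, m) \/ (j, k) = (m, ord_pred m)).

Definition diagram_knot : set S3 := [set Some (dcurve D t) | t in setT].

Definition homeomorphism (T U : topologicalType) (f : T -> U) :=
  exists g : U -> T, [/\ continuous f, continuous g, cancel f g & cancel g f].

(* [h] is an ambient isotopy carrying K onto the knot with diagram D: this is *)
(* what it means for D to be a diagram of K, and it makes K a tame knot.      *)
Definition isotopy_to_diagram (K : set S3) (h : R -> S3 -> S3) :=
  [/\ {within `[0, 1] `*` setT, continuous (fun q : R * S3 => h q.1 q.2)},
      forall x, h 0 x = x,
      forall t, 0 <= t <= 1 -> homeomorphism (h t) &
      h 1 @` K = diagram_knot].

Definition above (w : R * R * R) :=
  forall t, (dcurve D t).1 = w.1 -> (dcurve D t).2 < w.2.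

Definition above_cord (i j : 'I_(dn D)) (c : R -> R * R * R) :=
  [/\ {within `[0, 1], continuous c},
      exists2 s, knot_arc i s & c 0 = dcurve D s,
      exists2 t, knot_arc j t & c 1 = dcurve D t &
      forall t, 0 < t < 1 -> above (c t)].

End Diagram.

Arguments crossing {R} D.

Section CordRing.
Variables (S : comNzRingType) (n : nat) (crossing : 'I_n -> 'I_n -> 'I_n -> Prop).

Definition cord_var := {p : 'I_n * 'I_n | (p.1 < p.2)%N}.
Definition cord_poly := mpoly.mpoly #|{: cord_var}| S.
HB.instance Definition _ := GRing.ComNzRing.on cord_poly.

Definition cord_gen (i j : 'I_n) : cord_poly :=
  match insub (i, j), insub (j, i) with
  | Some v, _ | None, Some v => mpoly.mpolyX S (mpoly.mnm1 (enum_rank (v : cord_var)))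
  | None, None => 2
  end.

Definition cord_relators : set cord_poly :=
  [set q | exists i j k l, crossing i j k /\
     q = cord_gen l j + cord_gen l k - cord_gen l i * cord_gen i j].

Definition cord_ideal : {pred cord_poly} := ideal_gen cord_relators.

Definition cord_eval (B : comNzRingType) (f : {rmorphism S -> B})
    (h : 'I_n -> 'I_n -> B) : cord_poly -> B :=
  mpoly.mmap f (fun v => let p := val (enum_val v : cord_var) in h p.1 p.2).

HB.instance Definition _ (B : comNzRingType) (f : {rmorphism S -> B})
    (h : 'I_n -> 'I_n -> B) :=
  GRing.RMorphism.copy (cord_eval f h)
    (mpoly.mmap f (fun v => let p := val (enum_val v : cord_var) in h p.1 p.2)).

Lemma cord_evalE (B : comNzRingType) (f : {rmorphism S -> B}) (h : 'I_n -> 'I_n -> B) :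
  (forall i, h i i = 2) -> (forall i j, h i j = h j i) ->
  forall i j, cord_eval f h (cord_gen i j) = h i j.
Proof.
move=> h2 hC i j; rewrite /cord_gen.
case: insubP => [v vij vE|].
  by rewrite /cord_eval mpoly.mmapX mpoly.mmap1U enum_rankK vE.
move=> /= nij; case: insubP => [v vij vE|/= nji].
  by rewrite /cord_eval mpoly.mmapX mpoly.mmap1U enum_rankK vE /= hC.
case: (ltngtP i j) nij nji => // eij _ _.
by rewrite (ord_inj eij) h2 rmorph_nat.
Qed.

Lemma cord_eval_ideal (B : comNzRingType) (f : {rmorphism S -> B}) (h : 'I_n -> 'I_n -> B) :
  (forall i, h i i = 2) -> (forall i j, h i j = h j i) ->
  (forall i j k l, crossing i j k -> h l j + h l k = h l i * h i j) ->
  forall q, q \in cord_ideal -> cord_eval f h q = 0.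
Proof.
move=> h2 hC hR q /asboolP[k [c [r [gr ->]]]].
rewrite rmorph_sum big1// => a _; rewrite rmorphM/=.
case: (gr a) => i [j [l [m [cr ->]]]].
by rewrite rmorphB rmorphD rmorphM /= !cord_evalE// (hR _ _ _ _ cr) subrr mulr0.
Qed.

Lemma cord_ideal1 : 1 \notin cord_ideal.
Proof.
apply/negP => /(@cord_eval_ideal S idfun (fun _ _ => 2)) E.
have e : 2 + 2 = 2 * 2 :> S by rewrite mulr_natl mulr2n.
have /eqP := E (fun=> erefl) (fun _ _ => erefl) (fun _ _ _ _ _ => e).
by rewrite rmorph1 oner_eq0.
Qed.

HB.instance Definition _ := isIdealr.Build cord_poly cord_ideal (ideal_gen_closed cord_ideal1).

Definition cord_ring := {ideal_quot cord_ideal}.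
HB.instance Definition _ := NzRingQuotient.on cord_ring.
HB.instance Definition _ := GRing.ComNzRing.on cord_ring.

Definition cord (i j : 'I_n) : cord_ring := \pi_cord_ring (cord_gen i j).
Definition cord_scalar (a : S) : cord_ring := \pi_cord_ring (mpoly.mpolyC _ a).

Lemma cord_rel i j k l : crossing i j k ->
  cord l j + cord l k = cord l i * cord i j.
Proof.
move=> ijk; apply/eqP; rewrite -subr_eq0 /cord -rmorphM -rmorphD -rmorphB /=.
rewrite -(rmorph0 \pi_cord_ring) -Quotient.idealrBE subr0.
apply/asboolP; exists 1%N, (fun=> 1).
exists (fun=> cord_gen l j + cord_gen l k - cord_gen l i * cord_gen i j).
by split=> [_|]; [exists i, j, k, l|rewrite big_ord1 mul1r].
Qed.

Lemma cordii i : cord i i = 2.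
Proof. by rewrite /cord /cord_gen !insubF ?ltnn// rmorph_nat. Qed.

Lemma cordC i j : cord i j = cord j i.
Proof.
rewrite /cord /cord_gen.
case: insubP => [u uP _|_]; case: insubP => [w wP _|_] //=.
by move: uP wP => /= ij; rewrite ltnNge ltnW.
Qed.

Section Lift.
Variables (B : comNzRingType) (f : {rmorphism S -> B}) (v : 'I_n -> 'I_n -> B).
Hypotheses (v2 : forall i, v i i = 2) (vC : forall i j, v i j = v j i).
Hypothesis vR : forall i j k l, crossing i j k -> v l j + v l k = v l i * v i j.

Definition cord_lift (x : cord_ring) : B := cord_eval f v (repr x).

Lemma cord_lift_pi q : cord_lift (\pi_cord_ring q) = cord_eval f v q.
Proof.
apply/eqP; rewrite -subr_eq0 -rmorphB; apply/eqP/(cord_eval_ideal f v2 vC vR).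
by rewrite Quotient.idealrBE reprK.
Qed.

Lemma cord_lift_is_zmod_morphism : zmod_morphism cord_lift.
Proof.
by move=> x y; rewrite -[x]reprK -[y]reprK -rmorphB !cord_lift_pi rmorphB.
Qed.

Lemma cord_lift_is_monoid_morphism : monoid_morphism cord_lift.
Proof.
split; first by rewrite -(rmorph1 \pi_cord_ring) cord_lift_pi rmorph1.
by move=> x y; rewrite -[x]reprK -[y]reprK -rmorphM !cord_lift_pi rmorphM.
Qed.

HB.instance Definition _ :=
  GRing.isZmodMorphism.Build cord_ring B cord_lift cord_lift_is_zmod_morphism.
HB.instance Definition _ :=
  GRing.isMonoidMorphism.Build cord_ring B cord_lift cord_lift_is_monoid_morphism.

Lemma cord_lift_ex : exists phi : {rmorphism cord_ring -> B},
  (forall a, phi (cord_scalar a) = f a) /\ forall i j, phi (cord i j) = v i j.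
Proof.
exists cord_lift; split=> [a|i j] /=; first by rewrite cord_lift_pi /cord_eval mpoly.mmapC.
by rewrite cord_lift_pi cord_evalE.
Qed.

End Lift.

Lemma cord_ring_hom_eq (B : comNzRingType) (phi psi : {rmorphism cord_ring -> B}) :
  (forall a, phi (cord_scalar a) = psi (cord_scalar a)) ->
  (forall i j, phi (cord i j) = psi (cord i j)) -> phi =1 psi.
Proof.
move=> eS eC x; rewrite -[x]reprK; elim/mpoly.mpolyind: (repr x) => [|c m p _ _ IH].
  by rewrite !rmorph0.
rewrite !rmorphD IH -mpoly.mul_mpolyC !rmorphM [X in X * _ + _]eS; congr (_ * _ + _).
rewrite mpoly.mpolyXE_id !rmorph_prod; apply: eq_bigr => a _.
rewrite !rmorphXn; congr (_ ^+ _).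
pose v : cord_var := enum_val a.
have -> : mpoly.mpolyX S (mpoly.mnm1 a) = cord_gen (val v).1 (val v).2.
  by rewrite /cord_gen -surjective_pairing valK enum_valK.
exact: eC.
Qed.

End CordRing.

(* [cord_ring C] is the base change of [cord_ring int] along int -> C.         *)
Lemma cord_ring_tensor (C : comNzRingType) (n : nat)
    (crossing : 'I_n -> 'I_n -> 'I_n -> Prop) :
  exists iota : {rmorphism cord_ring int crossing -> cord_ring C crossing},
    (forall i j, iota (cord int crossing i j) = cord C crossing i j) /\
    forall (B : comAlgType C) (phi : {rmorphism cord_ring int crossing -> B}),
    exists2 psi : {rmorphism cord_ring C crossing -> B},
      (forall a, psi (cord_scalar crossing a) = a%:A) /\ psi \o iota =1 phi &
      forall psi' : {rmorphism cord_ring C crossing -> B},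
        (forall a, psi' (cord_scalar crossing a) = a%:A) ->
        psi' \o iota =1 phi -> psi' =1 psi.
Proof.
pose cint (B : pzRingType) : {rmorphism int -> B} := intmul 1.
have [iota [iS iC]] := cord_lift_ex (cint (cord_ring C crossing))
  (@cordii C n crossing) (@cordC C n crossing) (@cord_rel C n crossing).
exists iota; split=> // B phi.
have [|i j|i j k l ijk|psi [pS pC]] :=
  @cord_lift_ex C n crossing B (in_alg B) (fun i j => phi (cord int crossing i j)).
- by move=> i; rewrite cordii rmorph_nat.
- by rewrite cordC.
- by rewrite -rmorphD -rmorphM (@cord_rel int n crossing i j k l ijk).
have scalarE z : cord_scalar crossing z = z%:~R :> cord_ring int crossing.
  by rewrite /cord_scalar -[z in LHS]intz !rmorph_int.
exists psi => [|psi' pS' pC'].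
  split=> //; apply: cord_ring_hom_eq => [z|i j] /=.
    by rewrite !scalarE !rmorph_int.
  by rewrite /= iC pC.
apply: cord_ring_hom_eq => [a|i j]; first by rewrite pS' pS.
by rewrite -iC; have /= -> := pC' (cord int crossing i j); rewrite iC pC.
Qed.

Section KnotCordRings.
Variables (R : realType) (D : diagram R).

Definition HC0ab := cord_ring int (crossing D).
HB.instance Definition _ := GRing.ComNzRing.on HC0ab.

(* HC0ab tensored with the complex numbers, by [cord_ring_tensor] *)
Definition HC0ab_C := cord_ring R[i] (crossing D).
HB.instance Definition _ := GRing.ComNzRing.on HC0ab_C.

Definition c_int (i j : 'I_(dn D)) : HC0ab := cord int (crossing D) i j.
Definition c_C (i j : 'I_(dn D)) : HC0ab_C := cord R[i] (crossing D) i j.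
Definition scalar_C (a : R[i]) : HC0ab_C := cord_scalar (crossing D) a.

Definition augmentation_rank (eps : HC0ab -> R[i]) : nat :=
  \rank (\matrix_(i, j) eps (c_int i j)).

End KnotCordRings.

Section CharacterVariety.
Variables (R : realType) (G : groupType).
Local Notation C := R[i].

Record sl2_rep := SL2Rep {
  rep_mx :> G -> 'M[C]_2;
  rep_det : forall g, \det (rep_mx g) = 1;
  rep1 : rep_mx 1%g = 1%:M;
  repM : forall g h, rep_mx (g * h)%g = rep_mx g *m rep_mx h
}.

Record sl2_char := SL2Char {
  char_fun :> G -> C;
  char_funP : exists rho : sl2_rep, forall g, char_fun g = \tr (rho g)
}.

Definition trace_fun (g : G) : sl2_char -> C := fun chi => chi g.

(* X(G), the set of characters, is an affine algebraic set with the trace     *)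
(* functions as coordinates (finitely many of them suffice when G is finitely *)
(* generated), so its regular functions are the polynomials in the trace      *)
(* functions.                                                                 *)
Inductive regular : (sl2_char -> C) -> Prop :=
| regular_cst a : regular (cst a)
| regular_trace g : regular (trace_fun g)
| regular_add u v : regular u -> regular v -> regular (u + v)
| regular_mul u v : regular u -> regular v -> regular (u * v).

Definition regular_pred : {pred sl2_char -> C} := fun u => `[< regular u >].

Lemma regular_subring_closed : subring_closed regular_pred.
Proof.
split=> [|u v /asboolP ru /asboolP rv|u v /asboolP ru /asboolP rv].
- exact/asboolP/(regular_cst 1).
- have -> : u - v = u + cst (-1) * v by rewrite -[in LHS]mulN1r.
  by apply/asboolP/regular_add => //; apply: regular_mul => //; exact: regular_cst.
- exact/asboolP/regular_mul.
Qed.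

HB.instance Definition _ :=
  GRing.isSubringClosed.Build (sl2_char -> C) regular_pred regular_subring_closed.

Record regular_fun := RegularFun {
  regular_fun_val :> sl2_char -> C;
  _ : regular_fun_val \in regular_pred
}.

HB.instance Definition _ := [isSub for regular_fun_val].
HB.instance Definition _ := [Choice of regular_fun by <:].
HB.instance Definition _ := GRing.SubChoice_isSubComPzRing.Build
  (sl2_char -> C) regular_pred regular_fun (subringClosedP _).

End CharacterVariety.

Section BranchedCover.
Variables (R : realType) (T : topologicalType) (p : T -> S3 R) (K : set (S3 R)).
Local Notation R3 := (R * R * R)%type.

(* U is open and homeomorphic to R^3, with inverse homeomorphisms f and g. *)
Definition chart (X : topologicalType) (U : set X) (f : X -> R3) (g : R3 -> X) :=
  [/\ open U, {within U, continuous f}, continuous g,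
      forall v, U (g v) /\ f (g v) = v & forall x, U x -> g (f x) = x].

(* (w, t) |-> (w^2, t) on C x R *)
Definition branch_model (v : R3) : R3 :=
  (v.1.1 ^+ 2 - v.1.2 ^+ 2, 2 * v.1.1 * v.1.2, v.2).

Definition local_section (U : set (S3 R)) (s : S3 R -> T) :=
  [/\ {within U, continuous s}, forall x, U x -> p (s x) = x & open (s @` U)].

Definition double_branched_cover :=
  [/\ continuous p,
      forall x y : T, exists f : R -> T, is_path x y f,
      forall x, ~ K x -> exists U s1 s2,
        [/\ open U /\ U x, local_section U s1, local_section U s2,
            s1 @` U `&` s2 @` U = set0 & p @^-1` U = s1 @` U `|` s2 @` U] &
      forall x, K x -> exists U f f' g g',
        [/\ U x, chart U f f', chart (p @^-1` U) g g',
            forall y, U (p y) -> f (p y) = branch_model (g y) &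
            forall z, U z -> K z <-> (f z).1 = (0, 0)]].

End BranchedCover.

Section CordTrace.
Variables (R : realType) (D : diagram R) (h : R -> S3 R -> S3 R).
Variables (T : topologicalType) (p : T -> S3 R) (x0 : T).

(* The cord c of the knot with diagram D is viewed as the cord of K obtained  *)
(* by undoing the isotopy h; g1 and g2 are its two lifts.                     *)
Definition cord_lift_of (c : R -> R * R * R) (g : R -> T) :=
  {within `[0, 1], continuous g} /\
  forall t, 0 <= t <= 1 -> h 1 (p (g t)) = Some (c t).

Definition two_lifts c g1 g2 :=
  [/\ cord_lift_of c g1, cord_lift_of c g2 &
      exists2 t, 0 <= t <= 1 & g1 t <> g2 t].

(* a is, up to conjugation, the class of the loop d, whatever its base point. *)
Definition freely_represents (a : pi1 R x0) (d : R -> T) :=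
  exists (e : R -> T) (l : loop R x0),
    [/\ is_path x0 (d 0) e, loop_fun l = path_cat (path_cat e d) (path_rev e) &
        a = pi1_class l].

(* Z is the C-linear extension of c_ij |-> trace function of the loop formed  *)
(* by the two lifts, for every cord in the class c_ij.                        *)
Definition cord_trace_map (Z : HC0ab_C D -> regular_fun R (pi1 R x0)) :=
  (forall a chi, Z (scalar_C D a) chi = a) /\
  forall i j c g1 g2 a, above_cord i j c -> two_lifts c g1 g2 ->
    freely_represents a (path_cat g1 (path_rev g2)) ->
    forall chi, Z (c_C i j) chi = trace_fun a chi.

End CordTrace.

(* Main.v *)
Require Import Defs.
From HB Require Import structures.
From mathcomp Require Import all_boot all_order all_algebra.
From mathcomp Require Import complex ring lra zify.
From mathcomp Require Import all_classical all_reals all_analysis.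
Import numFieldNormedType.Exports.
Set Implicit Arguments.
Unset Strict Implicit.
Unset Printing Implicit Defensive.
Import Order.TTheory GRing.Theory Num.Theory.
Local Open Scope classical_set_scope.
Local Open Scope quotient_scope.
Local Open Scope ring_scope.

(** Cords decompose through an apex. Choose a point P high above the
    diagram and, for each arc i, a path s_i running from the arc straight up and
    then over to P. The cord c_ij is s_i followed by the reverse of s_j. In the
    branched double cover, s_i has exactly one lift al_i ending at a given
    preimage y1 of P, and one lift be_i ending at the other preimage y2; both
    start at the same point, over K. The two lifts of c_ij therefore form the
    loop al_i al_j^-1 be_j be_i^-1. With X_i := al_i^-1 be_i, a path from y1 to
    y2 that depends on the arc i alone, this loop is conjugate to X_j X_i^-1;
    closing up paths along a tree makes the X_i elements of the fundamental group.

    A character chi comes from a representation rho into SL_2, so it takes c_ij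
    to tr (rho X_j * adj (rho X_i)). That is a bilinear form on the space of 2 x 2
    matrices, of dimension four, evaluated at rho X_i and rho X_j: the matrix
    (chi c_ij) has rank at most four and all its 5 x 5 minors vanish
    ([det_trace_form], [det_char_eq0], [cord_traces]). On the other hand, an
    augmentation eps of rank at least five has a nonzero 5 x 5 minor
    ([exists_minor_neq0]). The element b is the corresponding minor of the
    generic matrix (c_ij): Z b vanishes at every character, while the complex
    extension of eps does not vanish at b, so that b is not nilpotent. As regular
    functions form a reduced ring, Z factors through the quotient by the
    nilradical, where the class of b is a nonzero element of the kernel.

    The topological input is the existence of the lifts al_i and be_i
    ([lift_branch]). Away from K, p is a covering; lifts on compact intervals are
    built by subdivision ([subinterval_ind]) and are determined by their end
    point. The path s_i meets K at time 0 only, so these lifts fit together on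
    the half-open interval, and in the local model (w, t) |-> (w^2, t) the
    equation w^2 -> 0 forces w -> 0, which gives continuity at time 0. The
    homotopy calculus needed to rewrite the loop is packed in [holonomy], which
    turns every path of the cover into an element of the fundamental group,
    multiplicatively. *)

(** * Minors and the trace form on 2 x 2 matrices *)

(** The rows picked by [maxrankfun] are independent, hence so are the first k of
    them; transposing, k columns are picked in the same way. *)
Lemma exists_minor_neq0 (F : fieldType) (m n k : nat) (A : 'M[F]_(m, n)) :
  (k <= \rank A)%N -> exists f g, \det (mxsub f g A : 'M[F]_k) != 0.
Proof.
move=> kr; pose f i := maxrankfun A (widen_ord kr i).
have fB : row_full (rowsub f A)^T.
  rewrite /row_full mxrank_tr -/(row_free _).
  have /row_freeP[B AB] := maxrowsub_free A.
  apply/row_freeP; exists (colsub (widen_ord kr) B); apply/matrixP => i j.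
  move/matrixP: AB => /(_ (widen_ord kr i) (widen_ord kr j)); rewrite !mxE.
  by move=> <-; apply: eq_bigr => l _; rewrite !mxE.
exists f, (fullrankfun fB); have := fullrowsub_unit fB.
rewrite unitmxE unitfE -det_tr; congr (\det _ != _).
by apply/matrixP => i j; rewrite !mxE.
Qed.

Lemma det_mul_narrow (F : fieldType) (k r : nat) (A : 'M[F]_(k, r)) B :
  (r < k)%N -> \det (A *m B) = 0.
Proof.
move=> rk; apply/eqP; rewrite -[_ == 0]negbK -unitfE -unitmxE -row_free_unit.
rewrite -row_leq_rank -ltnNge (leq_ltn_trans _ rk)//.
by rewrite (leq_trans (mxrankM_maxl _ _)) ?rank_leq_col.
Qed.

(** A trace is a sum over the four positions of a 2 x 2 matrix, here numbered by
    'I_4; this exhibits [det_trace_form] as the determinant of a product that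
    factors through a space of dimension four. *)
Lemma trace_adj2 (F : comNzRingType) (A B : 'M[F]_2) :
  \tr (A *m \adj B) =
  \sum_(l < 4) A (inord (l %/ 2)) (inord (l %% 2)) *
               (\adj B) (inord (l %% 2)) (inord (l %/ 2)).
Proof.
rewrite /mxtrace 2!big_ord_recl big_ord0 !mxE !big_ord_recl !big_ord0 /=.
rewrite !addr0 -!addrA; congr (_ * _ + (_ * _ + (_ * _ + _ * _)));
  congr (_ _ _); by apply: val_inj; rewrite /= inordK.
Qed.

Lemma det_trace_form (F : fieldType) (k : nat) (X Y : 'I_k -> 'M[F]_2) :
  (4 < k)%N -> \det (\matrix_(i, j) \tr (X j *m \adj (Y i))) = 0.
Proof.
move=> k4.
pose L := \matrix_(i < k, l < 4) (\adj (Y i)) (inord (l %% 2)) (inord (l %/ 2)).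
pose M := \matrix_(l < 4, j < k) X j (inord (l %/ 2)) (inord (l %% 2)).
rewrite -(det_mul_narrow L M k4); congr (\det _); apply/matrixP => i j.
rewrite [LHS]mxE trace_adj2 [RHS]mxE.
by apply: eq_bigr => l _; rewrite [RHS]mulrC !mxE.
Qed.

Section SL2.
Variables (R : realType) (G : groupType).

Lemma sl2_repV (rho : sl2_rep R G) g : rho g^-1%g = \adj (rho g).
Proof.
by rewrite -[LHS]mulmx1 -(rep_det rho g) -mul_mx_adj mulmxA -repM mulVg rep1 mul1mx.
Qed.

(** Conjugating by an element that depends on the entry does not change the
    trace, so the entries of M are values of the trace form. *)
Lemma det_char_eq0 (k : nat) (chi : sl2_char R G) (X Y : 'I_k -> G)
    (M : 'M[R[i]]_k) : (4 < k)%N ->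
  (forall i j, exists x, M i j = chi (x * X j * (Y i)^-1 * x^-1)%g) ->
  \det M = 0.
Proof.
move=> k4 MX; have [rho chiE] := char_funP chi.
rewrite -(det_trace_form (rho \o X) (rho \o Y) k4); congr (\det _).
apply/matrixP => i j; rewrite mxE; have [x ->] := MX i j.
rewrite chiE !repM mxtrace_mulC !mulmxA -repM mulVg rep1 mul1mx.
by rewrite sl2_repV.
Qed.

End SL2.

(** * Regular functions and quotient rings *)

Section Evaluation.
Variables (R : realType) (G : groupType) (A : comNzRingType).
Variables (Z : {rmorphism A -> regular_fun R G}).

Lemma regular_fun_rmorphism (chi : sl2_char R G) :
  exists phi : {rmorphism A -> R[i]}, phi =1 fun x => Z x chi.
Proof.
have zm : zmod_morphism (fun x => Z x chi) by move=> x y; rewrite rmorphB.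
have mm : monoid_morphism (fun x => Z x chi).
  by split=> [|x y]; rewrite ?rmorph1 ?rmorphM.
pose zI := GRing.isZmodMorphism.Build A R[i] _ zm.
pose mI := GRing.isMonoidMorphism.Build A R[i] _ mm.
pose f : {rmorphism A -> R[i]} := HB.pack (fun x => Z x chi) zI mI.
by exists f.
Qed.

Lemma regular_fun_eq0 (u : regular_fun R G) : (forall chi, u chi = 0) -> u = 0.
Proof. by move=> u0; apply/val_inj/funext. Qed.

(** The values of a regular function lie in a field. *)
Lemma nilradical_regular_fun x : x \in @nilradical A -> Z x = 0.
Proof.
move=> /asboolP[k xk]; apply: regular_fun_eq0 => chi.
have [phi phiE] := regular_fun_rmorphism chi; rewrite -phiE.
by have /eqP := rmorphXn phi k x; rewrite xk rmorph0 eq_sym expf_eq0 => /andP[_ /eqP].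
Qed.

End Evaluation.

Lemma ideal_quot_lift (A : comNzRingType) (I : Idealr.type A) (B : pzRingType)
    (Z : {rmorphism A -> B}) : (forall x, x \in (I : {pred A}) -> Z x = 0) ->
  exists Zq : {rmorphism {ideal_quot I} -> B}, forall x, Zq (\pi x) = Z x.
Proof.
move=> ZI; pose f (y : {ideal_quot I}) := Z (repr y).
have fpi x : f (\pi x) = Z x.
  apply/eqP; rewrite -subr_eq0 -rmorphB ZI//.
  by rewrite Quotient.idealrBE reprK.
have zm : zmod_morphism f.
  by move=> x y; rewrite -[x]reprK -[y]reprK -rmorphB !fpi rmorphB.
have mm : monoid_morphism f.
  split=> [|x y]; first by rewrite -(rmorph1 \pi_{ideal_quot I}) fpi rmorph1.
  by rewrite -[x]reprK -[y]reprK -rmorphM !fpi rmorphM.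
pose zI := GRing.isZmodMorphism.Build _ _ _ zm.
pose mI := GRing.isMonoidMorphism.Build _ _ _ mm.
pose g : {rmorphism {ideal_quot I} -> B} := HB.pack f zI mI.
by exists g.
Qed.

(** * Path homotopies and holonomy *)

Section PathAlgebra.
Variables (R : realType) (T : topologicalType).
Implicit Types (f g h : R -> T) (x y z w : T).

(** The associativity, unit and inverse laws below are of this kind: both sides are
    reparametrizations of one path, and a linear interpolation between the
    parameters is a homotopy. *)
Lemma path_reparam f g h (phi psi : R -> R) x y x' y' :
  {within `[0, 1], continuous f} -> is_path x y g -> is_path x' y' h ->
  continuous phi -> continuous psi ->
  (forall t : R, 0 <= t <= 1 -> 0 <= phi t <= 1 /\ 0 <= psi t <= 1) ->
  phi 0 = psi 0 -> phi 1 = psi 1 ->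
  (forall t : R, 0 <= t <= 1 -> f (phi t) = g t) ->
  (forall t : R, 0 <= t <= 1 -> f (psi t) = h t) ->
  path_homotopic g h.
Proof.
move=> cf [cg _ _] [ch _ _] cphi cpsi rng e0 e1 fg fh.
apply: (@homotopic_trans _ _ _ (f \o phi)).
  by apply: eq_homotopic => // t; rewrite in_itv => /fg.
apply: (@homotopic_trans _ _ _ (f \o psi)).
  by apply: reparam_homotopic => // t; rewrite !in_itv => /rng.
by apply/homotopic_sym/eq_homotopic => // t; rewrite in_itv => /fh.
Qed.

Let cid : continuous (fun t : R => t). Proof. by move=> t; exact: cvg_id. Qed.
Let caff (a b : R) : continuous (fun t : R => a * t + b).
Proof. exact: continuous_affine. Qed.
Let cmin (f g : R -> R) : continuous f -> continuous g ->
  continuous (fun t => Num.min (f t) (g t)).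
Proof. by move=> cf cg t; apply: continuous_min; [exact: cf|exact: cg]. Qed.
Let cmax (f g : R -> R) : continuous f -> continuous g ->
  continuous (fun t => Num.max (f t) (g t)).
Proof. by move=> cf cg t; apply: continuous_max; [exact: cf|exact: cg]. Qed.

Lemma path_catA x y z w f g h :
  is_path x y f -> is_path y z g -> is_path z w h ->
  path_homotopic (path_cat (path_cat f g) h) (path_cat f (path_cat g h)).
Proof.
move=> pf pg ph; have pL := is_path_cat (is_path_cat pf pg) ph.
have pR := is_path_cat pf (is_path_cat pg ph); have [cR _ _] := pR.
apply: (path_reparam (f := path_cat f (path_cat g h))
  (* the piecewise linear map that sends 1/4 to 1/2 and 1/2 to 3/4 *)
  (phi := fun t => Num.min (2 * t + 0) (Num.min (1 * t + 4^-1) (2^-1 * t + 2^-1)))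
  (psi := id) cR pL pR) => //; clear pf pg ph pL pR cR.
- by do 2?apply: cmin.
- move=> t tI; split=> //.
  case: (leP (1 * t + 4^-1) (2^-1 * t + 2^-1)) => ?;
  by case: (leP (2 * t + 0) _) => ?; lra.
- by rewrite !min_l; lra.
- by rewrite !min_r; lra.
- move=> t tI; rewrite /path_cat.
  case: (leP (1 * t + 4^-1) (2^-1 * t + 2^-1)) => ?;
  case: (leP (2 * t + 0) _) => ?;
  do ?case: ifPn; rewrite -?ltNge; move=> *;
  by first [exfalso; lra | congr (_ _); lra].
Qed.

Lemma path_cat1 x y f : is_path x y f -> path_homotopic (path_cat (cst x) f) f.
Proof.
move=> pf; have [cf f0 f1] := pf; have pL := is_path_cat (is_path_cst R x) pf.
apply: (path_reparam (phi := fun t => Num.max (0 * t + 0) (2 * t + - 1))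
  (psi := id) cf pL pf) => //.
- by apply: cmax.
- by move=> t tI; split=> //; rewrite !maxElt; case: ltP => *; clear f0 f1; lra.
- by rewrite !maxElt; case: ltP => *; clear f0 f1; lra.
- by rewrite !maxElt; case: ltP => *; clear f0 f1; lra.
- move=> t tI; rewrite /path_cat !maxElt /cst -f0; clear pf f0 f1 pL.
  case: ltP => ?; do ?case: ifPn; rewrite -?ltNge; move=> *;
  by first [exfalso; lra | congr (f _); lra].
Qed.

Lemma path_catV x y f : is_path x y f ->
  path_homotopic (path_cat (path_rev f) f) (cst y).
Proof.
move=> pf; have [cf f0 f1] := pf; have pL := is_path_cat (is_path_rev pf) pf.
apply: (path_reparam (phi := fun t => Num.max (- 2 * t + 1) (2 * t + - 1))
  (psi := fun t => 0 * t + 1) cf pL (is_path_cst R y)) => //.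
- by apply: cmax.
- by move=> t tI; split; [rewrite maxElt; case: ltP => *|]; clear f0 f1; lra.
- by rewrite !maxElt; case: ltP => *; clear f0 f1; lra.
- by rewrite !maxElt; case: ltP => *; clear f0 f1; lra.
- move=> t tI; rewrite /path_cat /path_rev !maxElt; clear pf f0 f1 pL.
  case: ltP => ?; do ?case: ifPn; rewrite -?ltNge; move=> *;
  by first [exfalso; lra | congr (f _); lra].
- by move=> t _; rewrite mul0r add0r f1.
Qed.

Lemma path_revK f : path_rev (path_rev f) = f.
Proof. by apply/funext => t; rewrite /path_rev subKr. Qed.

Lemma path_catVr x y f : is_path x y f ->
  path_homotopic (path_cat f (path_rev f)) (cst x).
Proof. by move=> /is_path_rev/path_catV; rewrite path_revK. Qed.

Lemma path_homotopic_refl x y f : is_path x y f -> path_homotopic f f.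
Proof. by move=> [cf _ _]; apply: eq_homotopic. Qed.

Lemma path_catl x y z f f' g : is_path x y f -> is_path y z g ->
  path_homotopic f f' -> path_homotopic (path_cat f g) (path_cat f' g).
Proof.
by move=> pf pg ff'; apply: (path_cat_homotopic pf pg ff' (path_homotopic_refl pg)).
Qed.

Lemma path_catr x y z f g g' : is_path x y f -> is_path y z g ->
  path_homotopic g g' -> path_homotopic (path_cat f g) (path_cat f g').
Proof.
by move=> pf pg; apply: (path_cat_homotopic pf pg (path_homotopic_refl pf)).
Qed.

End PathAlgebra.

Section Holonomy.
Variables (R : realType) (T : topologicalType) (x0 : T) (e : T -> R -> T).
Hypothesis eP : forall x, is_path x0 x (e x).

(** A total function, so that no proof of being a loop has to be carried along;
    the value outside loops is arbitrary. *)
Definition pi1_of (l : R -> T) : pi1 R x0 :=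
  if pselect (is_path x0 x0 l) is left lP then pi1_class (Loop lP) else 1%g.

Lemma pi1_of_loop (l : loop R x0) : pi1_of l = pi1_class l.
Proof.
rewrite /pi1_of; case: pselect => [lP|[]]; last exact: loopP.
by apply/pi1_classP; apply: (path_homotopic_refl lP).
Qed.

Lemma eq_pi1_of f g : is_path x0 x0 f -> is_path x0 x0 g ->
  path_homotopic f g -> pi1_of f = pi1_of g.
Proof.
by move=> pf pg fg; rewrite (pi1_of_loop (Loop pf)) (pi1_of_loop (Loop pg));
  apply/pi1_classP.
Qed.

Lemma pi1_ofM f g : is_path x0 x0 f -> is_path x0 x0 g ->
  (pi1_of f * pi1_of g)%g = pi1_of (path_cat f g).
Proof.
move=> pf pg; rewrite (pi1_of_loop (Loop pf)) (pi1_of_loop (Loop pg)).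
by rewrite [RHS](pi1_of_loop (loop_cat (Loop pf) (Loop pg))) -pi1_classM.
Qed.

Definition based f := path_cat (path_cat (e (f 0)) f) (path_rev (e (f 1))).

(** The paths [e x] play the role of a spanning tree: closing up a path along them
    identifies the fundamental groupoid with the fundamental group, which allows
    the computation with paths of different end points to take place in a group. *)
Definition holonomy f := pi1_of (based f).

Lemma is_path_based x y f : is_path x y f -> is_path x0 x0 (based f).
Proof.
move=> pf; have [_ f0 f1] := pf; rewrite /based f0 f1.
exact: (is_path_cat (is_path_cat (eP x) pf) (is_path_rev (eP y))).
Qed.

(** After reassociation, the tree path to y is travelled back and forth, and
    cancels. *)
Lemma holonomyM x y z f g : is_path x y f -> is_path y z g ->
  holonomy (path_cat f g) = (holonomy f * holonomy g)%g.
Proof.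
move=> pf pg; rewrite pi1_ofM; [|exact: (is_path_based pf)|exact: (is_path_based pg)].
have pfg := is_path_cat pf pg.
apply/esym/eq_pi1_of.
- exact: (is_path_cat (is_path_based pf) (is_path_based pg)).
- exact: (is_path_based pfg).
have [_ f0 f1] := pf; have [_ g0 g1] := pg; have [_ h0 h1] := pfg.
rewrite /based f0 f1 g0 g1 h0 h1.
have ex := eP x; have ey := eP y; have Ez := is_path_rev (eP z).
have Ey := is_path_rev ey; have exf := is_path_cat ex pf; have eyg := is_path_cat ey pg.
have gEz := is_path_cat pg Ez.
apply: homotopic_trans (path_catA exf Ey (is_path_cat eyg Ez)) _.
apply: (@homotopic_trans _ _ _ (path_cat (path_cat (e x) f) (path_cat g (path_rev (e z))))).
  apply: (path_catr exf (is_path_cat Ey (is_path_cat eyg Ez))).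
  apply: (@homotopic_trans _ _ _ (path_cat (path_rev (e y)) (path_cat (e y) (path_cat g (path_rev (e z)))))).
    exact: (path_catr Ey (is_path_cat eyg Ez) (path_catA ey pg Ez)).
  apply: homotopic_trans (homotopic_sym (path_catA Ey ey gEz)) _.
  apply: homotopic_trans (path_catl (is_path_cat Ey ey) gEz (path_catV ey)) _.
  exact: path_cat1 gEz.
apply: homotopic_trans (homotopic_sym (path_catA exf pg Ez)) _.
exact: (path_catl (is_path_cat exf pg) Ez (path_catA ex pf pg)).
Qed.

Lemma holonomy_cst x : holonomy (cst x) = 1%g.
Proof.
have pc := is_path_cst R x; apply: (mulgI (holonomy (cst x))).
rewrite -(holonomyM pc pc) mulg1; congr holonomy.
by apply/funext => t; rewrite /path_cat; case: ifP.
Qed.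

Lemma holonomyV x y f : is_path x y f -> holonomy (path_rev f) = ((holonomy f)^-1)%g.
Proof.
move=> pf; have pr := is_path_rev pf; have pfr := is_path_cat pf pr.
have pc := is_path_cst R x.
apply: (mulgI (holonomy f)); rewrite -(holonomyM pf pr) mulgV -(holonomy_cst x).
apply: eq_pi1_of; [exact: is_path_based pfr|exact: is_path_based pc|].
have [_ h0 h1] := pfr; rewrite /based h0 h1.
apply: (path_catl (is_path_cat (eP x) pfr) (is_path_rev (eP x))).
exact: (path_catr (eP x) pfr (path_catVr pf)).
Qed.

End Holonomy.

(** * Lifting paths to the branched double cover *)

(** A property of intervals that holds locally and is preserved by concatenation
    holds for the whole interval: the supremum of the end points reached from a
    is itself reached, and can be passed unless it is b. *)
Lemma subinterval_ind (R : realType) (P : R -> R -> Prop) (a b : R) : a <= b ->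
  (forall x y z, x <= y -> y <= z -> P x y -> P y z -> P x z) ->
  (forall t, a <= t <= b -> exists2 d, 0 < d & forall x y,
    a <= x -> t - d < x -> x <= t -> t <= y -> y < t + d -> y <= b -> P x y) ->
  P a b.
Proof.
move=> ab Pcat Ploc.
pose S := [set y | a <= y <= b /\ P a y].
have Sa : S a.
  split; first by rewrite lexx.
  by have [|d d0 Pd] := Ploc a; [rewrite lexx|apply: Pd; lra].
have ubS : ubound S b by move=> y [/andP[]].
have hS : has_sup S by split; [exists a|exists b].
have sab : a <= sup S <= b.
  by apply/andP; split; [apply: ub_le_sup => //; exists b|apply: ge_sup => //; exists a].
have [d d0 Pd] := Ploc _ sab.
have [y [/andP[ay yb] Pay] sdy] := sup_adherent d0 hS.
have ys : y <= sup S by apply: ub_le_sup; [exists b|split=> //; lra].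
pose y' := Num.min b (sup S + d / 2).
have sy' : sup S <= y' by rewrite le_min; lra.
have y'b : y' <= b by rewrite ge_min lexx.
have Pay' : P a y'.
  apply: (Pcat a y y') => //; first by rewrite (le_trans ys).
  by apply: Pd => //; rewrite gt_min; apply/orP; right; lra.
have : y' <= sup S by apply: ub_le_sup; [exists b|split=> //; lra].
by move: Pay'; rewrite /y'; case: (leP b) => // _ _; lra.
Qed.

Lemma within_near (R : realType) (X : topologicalType) (A : set R) (q : R -> X)
    (U : set X) t : {within A, continuous q} -> A t -> open U -> U (q t) ->
  exists2 d, 0 < d & forall r, A r -> t - d < r -> r < t + d -> U (q r).
Proof.
move=> /within_cvgP cq At oU Uqt.
have /nbhs_ballP[d /= d0 dU] := cq t At U (open_nbhs_nbhs (conj oU Uqt)).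
exists d => // r Ar r1 r2; apply: dU => //.
by rewrite /ball /= ltr_norml; lra.
Qed.

Lemma within_itvW (R : realType) (X : topologicalType) (q : R -> X) (a b a' b' : R) :
  a <= a' -> b' <= b -> {within `[a, b], continuous q} ->
  {within `[a', b'], continuous q}.
Proof. by move=> aa bb; apply: continuous_subspaceW => t; rewrite /= !in_itv/=; lra. Qed.

Section BranchModel.
Variable R : realType.

(** |w^2|^2 = |w|^4 for w = u + iv. *)
Lemma branch_model_norm (v : R * R * R) :
  (v.1.1 ^+ 2 + v.1.2 ^+ 2) ^+ 2 =
  (branch_model v).1.1 ^+ 2 + (branch_model v).1.2 ^+ 2.
Proof. by rewrite /branch_model /=; ring. Qed.

Lemma branch_model_inv0 (v : R * R * R) c : branch_model v = (0, 0, c) -> v = (0, 0, c).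
Proof.
move=> vE; have := branch_model_norm v; rewrite vE expr0n addr0 => /eqP.
rewrite expf_eq0 /= paddr_eq0 ?sqr_ge0// !sqrf_eq0 => /andP[/eqP u0 /eqP v0].
by move: vE u0 v0; case: v => -[u v] t /= [_ _ ->] -> ->.
Qed.

(** If w^2 tends to 0 then so does w. *)
Lemma cvg_branch_model (F : set_system R) {FF : Filter F} (k : R -> R * R * R) (c : R) :
  branch_model (k t) @[t --> F] --> ((0, 0, c) : R * R * R) ->
  k t @[t --> F] --> ((0, 0, c) : R * R * R).
Proof.
move=> kc.
have k2 : (k t).2 @[t --> F] --> c.
  by apply: (cvg_comp _ snd kc); exact: cvg_snd.
have k1 : (branch_model (k t)).1 @[t --> F] --> ((0, 0) : R * R).
  by apply: (cvg_comp _ fst kc); exact: cvg_fst.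
have kA : (branch_model (k t)).1.1 @[t --> F] --> (0 : R).
  by apply: (cvg_comp _ fst k1); exact: cvg_fst.
have kB : (branch_model (k t)).1.2 @[t --> F] --> (0 : R).
  by apply: (cvg_comp _ snd k1); exact: cvg_snd.
have small (e : R) : 0 < e -> \forall t \near F, `|(k t).1.1| < e /\ `|(k t).1.2| < e.
  move=> e0; have e2 : 0 < e ^+ 2 / 2 by nra.
  have nA := (cvgr0Pnorm_lt (FF := FF) _).1 kA _ e2; have nB := (cvgr0Pnorm_lt (FF := FF) _).1 kB _ e2.
  apply: (filterS2 _ _ nA nB) => t.
  cbv beta; move: (branch_model_norm (k t)); rewrite !ltr_norml.
  move: (branch_model _).1.1 (branch_model _).1.2 => A B.
  move: (k t).1.1 (k t).1.2 => u v uv AB1 AB2.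
  have : (u ^+ 2 + v ^+ 2) ^+ 2 < (e ^+ 2) ^+ 2 by rewrite uv; nra.
  rewrite ltr_pXn2r ?nnegrE ?addr_ge0 ?sqr_ge0//; nra.
rewrite [k](_ : _ = fun t => ((k t).1.1, (k t).1.2, (k t).2)); last first.
  by apply/funext => t; case: (k t) => -[].
have ku : (k t).1.1 @[t --> F] --> (0 : R).
  by apply/(cvgr0Pnorm_lt (FF := FF)) => e /small; apply: filterS => t [].
have kv : (k t).1.2 @[t --> F] --> (0 : R).
  by apply/(cvgr0Pnorm_lt (FF := FF)) => e /small; apply: filterS => t [].
exact: (cvg_pair (cvg_pair ku kv) k2).
Qed.

End BranchModel.

Section PathLifting.
Variables (R : realType) (T : topologicalType) (p : T -> S3 R) (K : set (S3 R)).
Hypothesis hp : double_branched_cover p K.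

Definition is_lift (a b : R) (q : R -> S3 R) (f : R -> T) :=
  {within `[a, b], continuous f} /\ forall t, a <= t <= b -> p (f t) = q t.

Lemma is_liftW a b a' b' q f : a <= a' -> b' <= b -> is_lift a b q f -> is_lift a' b' q f.
Proof.
move=> aa bb [cf pf]; split=> [|t tab]; last by apply: pf; lra.
exact: within_itvW cf.
Qed.

Lemma is_lift_paste a b c q f g : a <= b -> b <= c -> f b = g b ->
  is_lift a b q f -> is_lift b c q g ->
  is_lift a c q (fun t => if t <= b then f t else g t).
Proof.
move=> ab bc fgb [cf pf] [cg pg]; split=> [|t tac]; last first.
  by case: leP => tb; [apply: pf|apply: pg]; lra.
apply: (@within_paste _ _ _ [set t | t <= b] [set t | b <= t] _ f g).
- exact: interval_closed.
- exact: closed_le.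
- exact: closed_ge.
- by move=> t _; apply/orP/le_total.
- by apply: continuous_subspaceW cf => t [/=]; rewrite !in_itv/=; lra.
- by apply: continuous_subspaceW cg => t [/=]; rewrite !in_itv/=; lra.
- by move=> t; rewrite inE => -[_ /= ->].
- move=> t; rewrite inE => -[/= _ bt]; case: leP => // tb.
  by have -> : t = b by apply/le_anti; rewrite tb bt.
Qed.

(** On a small interval the lift is one of the two local sections composed with
    q; pieces are glued from right to left since the end point is prescribed. *)
Lemma lift_exists (a b : R) q y : a <= b -> {within `[a, b], continuous q} ->
  (forall t, a <= t <= b -> ~ K (q t)) -> p y = q b ->
  exists2 f, is_lift a b q f & f b = y.
Proof.
move=> ab cq qK; have [_ _ even _] := hp.
pose P x z := forall e, p e = q z -> exists2 f, is_lift x z q f & f z = e.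
move: y; apply: (@subinterval_ind _ P a b ab).
- move=> x z w xz zw Pxz Pzw e ew.
  have [g lg gw] := Pzw e ew.
  have [|f lf fz] := Pxz (g z); first by apply: lg.2; rewrite lexx.
  exists (fun t => if t <= z then f t else g t); first exact: is_lift_paste.
  rewrite /=; case: leP => // wz; have e' : w = z by apply/le_anti; rewrite wz zw.
  by rewrite e' fz -e'.
move=> t tab; have [U [s1 [s2 [[oU Uqt] [cs1 ps1 _] [cs2 ps2 _] _ pU]]]] := even _ (qK t tab).
have [|d d0 qU] := within_near cq _ oU Uqt; first by rewrite /= in_itv.
exists d => // x z ax tdx xt tz ztd zb e ez.
have qxz r : `[x, z]%classic r -> U (q r).
  by rewrite /= in_itv/= => rxz; apply: qU; rewrite /= ?in_itv/=; lra.
have lift s : {within U, continuous s} -> (forall u, U u -> p (s u) = u) ->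
    is_lift x z q (s \o q).
  move=> cs ps; split=> [|r rxz]; last by apply/ps/qxz; rewrite /= in_itv.
  apply: (within_comp _ qxz cs); exact: (within_itvW ax zb cq).
have Uz : U (q z) by apply: qxz; rewrite /= in_itv/=; lra.
have : (p @^-1` U) e by rewrite /= ez.
rewrite pU => -[[u Uu ue]|[u Uu ue]].
- exists (s1 \o q); first exact: lift.
  by rewrite /= -ez -ue ps1.
- exists (s2 \o q); first exact: lift.
  by rewrite /= -ez -ue ps2.
Qed.

(** Both sheets are open, so near each time a lift stays in one sheet, where p is
    injective. Two lifts that agree somewhere nearby are then in the same sheet,
    because the sheets are disjoint. *)
Lemma lift_unique (a b : R) q f g : a <= b ->
  (forall t, a <= t <= b -> ~ K (q t)) ->
  is_lift a b q f -> is_lift a b q g -> f b = g b -> f a = g a.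
Proof.
move=> ab qK [cf pf] [cg pg]; have [_ _ even _] := hp.
apply: (@subinterval_ind _ (fun x y => f y = g y -> f x = g x) a b ab).
  by move=> x y z _ _ fgx fgy /fgy/fgx.
move=> t tab; have tab' : `[a, b]%classic t by rewrite /= in_itv.
have [U [s1 [s2 [[oU Uqt] [_ ps1 oV1] [_ ps2 oV2] V12 pU]]]] := even _ (qK t tab).
have inj (s : S3 R -> T) e e' : (forall u, U u -> p (s u) = u) ->
    (s @` U) e -> (s @` U) e' -> p e = p e' -> e = e'.
  by move=> ps [u Uu <-] [u' Uu' <-]; rewrite !ps// => ->.
have sheet (k : R -> T) : {within `[a, b], continuous k} -> p (k t) = q t ->
    exists2 d, 0 < d &
      (forall r, a <= r <= b -> t - d < r < t + d -> (s1 @` U) (k r)) \/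
      (forall r, a <= r <= b -> t - d < r < t + d -> (s2 @` U) (k r)).
  move=> ck pk; have : (p @^-1` U) (k t) by rewrite /= pk.
  rewrite pU => -[kt|kt].
  - have [d d0 dU] := within_near ck tab' oV1 kt; exists d => //; left => r rab rt.
    by apply: dU; rewrite /= ?in_itv//; lra.
  - have [d d0 dU] := within_near ck tab' oV2 kt; exists d => //; right => r rab rt.
    by apply: dU; rewrite /= ?in_itv//; lra.
have [d d0 fV] := sheet f cf (pf _ tab).
have [d' d'0 gV] := sheet g cg (pg _ tab).
exists (Num.min d d'); first by rewrite lt_min d0.
move=> x y ax tx xt ty yt yb fgy.
have dd : Num.min d d' <= d by rewrite ge_min lexx.
have dd' : Num.min d d' <= d' by rewrite ge_min lexx orbT.
have [{}dd {}dd'] : (t - d < x /\ y < t + d) /\ (t - d' < x /\ y < t + d').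
  by split; lra.
have pfg : p (f x) = p (g x) by rewrite pf ?pg//; lra.
have V0 e : (s1 @` U) e -> (s2 @` U) e -> f x = g x.
  by move=> e1 e2; have : (s1 @` U `&` s2 @` U) e by []; rewrite V12.
have [] : (forall r, x <= r <= y -> (s1 @` U) (f r)) \/ (forall r, x <= r <= y -> (s2 @` U) (f r)).
  by case: fV => fV; [left|right] => r rxy; apply: fV; lra.
all: have [] : (forall r, x <= r <= y -> (s1 @` U) (g r)) \/ (forall r, x <= r <= y -> (s2 @` U) (g r)) by
  case: gV => gV; [left|right] => r rxy; apply: gV; lra.
all: move=> {}gV {}fV.
- by apply: (inj s1 _ _ ps1) => //; [apply: fV|apply: gV]; lra.
- by apply: (V0 (f y)); [apply: fV|rewrite fgy; apply: gV]; lra.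
- by apply: (V0 (f y)); [rewrite fgy; apply: gV|apply: fV]; lra.
- by apply: (inj s2 _ _ ps2) => //; [apply: fV|apply: gV]; lra.
Qed.

(** The only point of the model mapped to the axis point (0, 0, c) is that point
    itself. *)
Lemma branch_point (x : S3 R) : K x -> exists2 z, p z = x & forall z', p z' = x -> z' = z.
Proof.
have [_ _ _ branch] := hp.
move=> Kx; have [U [f [f' [g [g' [Ux [oU cf cf' fK' f'K] [oV cg cg' gK' g'K] pE UK]]]]]] := branch _ Kx.
have fx : f x = (0, 0, (f x).2).
  by have := (UK _ Ux).1 Kx; case: (f x) => [w t] /= ->.
have [Vz gz] := gK' (f x).
exists (g' (f x)) => [|z' pz'].
  rewrite -[RHS]f'K// -[LHS]f'K//; congr f'; rewrite pE// gz.
  by rewrite fx /branch_model /= expr0n subrr !mulr0.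
have Vz' : (p @^-1` U) z' by rewrite /= pz'.
rewrite -[LHS]g'K//; congr g'; rewrite -pz' pE//.
have gx : branch_model (g z') = (0, 0, (f x).2) by rewrite -pE// pz'.
by rewrite (branch_model_inv0 gx) /branch_model /= expr0n subrr !mulr0.
Qed.

(** By uniqueness, the lifts on [a, 1] for a > 0 are restrictions of each other
    and define a lift on the half-open interval. Its value at 0 is the unique point
    over q 0; continuity there is checked in the branched chart around it. *)
Lemma lift_branch (q : R -> S3 R) y : {within `[0, 1], continuous q} ->
  K (q 0) -> (forall t, 0 < t <= 1 -> ~ K (q t)) -> p y = q 1 ->
  exists2 f, is_lift 0 1 q f & f 1 = y.
Proof.
move=> cq Kq0 nKq py.
have LP (a : R) : exists f : R -> T, 0 < a <= 1 -> is_lift a 1 q f /\ f 1 = y.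
  have [a01|na] := pselect (0 < a <= 1); last by exists (cst y).
  have [||||f lf f1] := @lift_exists a 1 q y => //; first by lra.
  - by apply: (within_itvW _ _ cq); lra.
  - by move=> t ta; apply: nKq; lra.
  - by exists f.
have [L LE] := choice LP.
have [z pz _] := branch_point Kq0.
(* L t is a lift on [t, 1]; its value at t is the one shared by all of them *)
pose f t := if 0 < t then L t t else z.
have fL (a t : R) : 0 < a -> a <= t <= 1 -> f t = L a t.
  move=> a0 /andP[at_ t1]; have t0 : 0 < t by lra.
  rewrite /f t0; have [|lt lt1] := LE t; first by rewrite t0.
  have [|la la1] := LE a; first by lra.
  apply: (@lift_unique t 1 q (L t) (L a)) => //; last by rewrite lt1 la1.
    by move=> s st; apply: nKq; lra.
  exact: is_liftW la.
have pf t : 0 <= t <= 1 -> p (f t) = q t.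
  move=> /andP[t0 t1]; rewrite /f; case: ltP => [tp|t0'].
    have [|[_ pL] _] := LE t; first by rewrite tp.
    by apply: pL; lra.
  by have -> : t = 0 by apply/le_anti; rewrite t0 t0'.
exists f; last by rewrite (fL 1) ?lexx//; have [|_] := LE 1; rewrite ?ltr01 ?lexx.
split=> //; apply/within_cvgP => t; rewrite /= in_itv/= => /andP[t0 t1].
case: (ltP 0 t) => [tp|t0'].
  pose a := t / 2.
  have [|[/within_cvgP cL _] _] := LE a; first by rewrite /a; lra.
  rewrite (fL a) //; [|rewrite /a; lra..].
  have ta : a <= t <= 1 by rewrite /a; lra.
  have := cL t; rewrite /= in_itv/= => /(_ ta) cLt.
  move=> V /cLt; rewrite /nbhs /= /within /= => VL.
  have near_a : \forall s \near t, a < s by apply: lt_nbhsr; rewrite /a; lra.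
  apply: (filterS2 _ _ VL near_a) => s VLs as_; rewrite /= !in_itv/= => s01.
  by rewrite (fL a); [apply: VLs; rewrite /= in_itv|rewrite /a; lra|]; rewrite /= ; lra.
have {t0 t1 t0'} -> : t = 0 by apply/le_anti; rewrite t0 t0'.
have [_ _ _ branch] := hp.
have [U [g [g' [k [k' [Ux [oU cg _ _ g'K] [oV ck ck' kK' k'K] pE UK]]]]]] := branch _ Kq0.
have I0 : `[0 : R, 1]%classic 0 by rewrite /= in_itv/= lexx ler01.
(* continuity at 0, in the charts g of the base and k of the cover *)
have qU : \forall s \near within `[0, 1]%classic (nbhs (0 : R)), U (q s).
  by move/within_cvgP: cq => /(_ 0 I0 U); apply; apply: open_nbhs_nbhs.
have I01 : \forall s \near within `[0, 1]%classic (nbhs (0 : R)), 0 <= s <= 1.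
  by apply: (filterS _ (withinT _ _)) => s; rewrite /= in_itv.
have gq0 : g (q 0) = (0, 0, (g (q 0)).2).
  by have := (UK _ Ux).1 Kq0; case: (g (q 0)) => [w t'] /= ->.
have gq : g (q t) @[t --> within `[0, 1] (nbhs (0 : R))] --> g (q 0).
  move=> W /((within_cvgP _ _).1 cg _ Ux) Wg.
  move/within_cvgP: cq => /(_ 0 I0 _ Wg) Wgq.
  by apply: (filterS2 _ _ qU Wgq) => s qs; apply.
have kf : k (f t) @[t --> within `[0, 1] (nbhs (0 : R))] --> ((0, 0, (g (q 0)).2) : R * R * R).
  apply: cvg_branch_model; rewrite -gq0.
  apply: cvg_trans gq; apply: near_eq_cvg.
  by apply: (filterS2 _ _ qU I01) => s Us s01; rewrite -pE pf.
have pf0 : p (f 0) = q 0 by rewrite pf// lexx ler01.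
have kf0 : k (f 0) = (0, 0, (g (q 0)).2).
  by apply: branch_model_inv0; rewrite -pE /= ?pf0.
rewrite -(k'K (f 0)); last by rewrite /= pf0.
rewrite kf0; apply: cvg_trans (cvg_comp _ k' kf (ck' _)); apply: near_eq_cvg.
by apply: (filterS2 _ _ qU I01) => s Us s01; rewrite /= k'K//= pf.
Qed.

Lemma two_preimages (x : S3 R) : ~ K x -> exists y1 y2, [/\ p y1 = x, p y2 = x & y1 <> y2].
Proof.
have [_ _ even _] := hp.
move=> /even[U [s1 [s2 [[_ Ux] [_ ps1 _] [_ ps2 _] V12 _]]]].
exists (s1 x), (s2 x); split; [exact: ps1|exact: ps2|move=> s12].
have : (s1 @` U `&` s2 @` U) (s1 x) by split; [|rewrite s12]; exists x.
by rewrite V12.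
Qed.

End PathLifting.

(** * Cords above a diagram *)

Section DiagramCords.
Variables (R : realType) (D : diagram R).

Lemma dcurve_intmod (t : R) (m : int) : dcurve D (t + m%:~R) = dcurve D t.
Proof.
have nat_mod s k : dcurve D (s + k%:R) = dcurve D s.
  by elim: k => [|k IH]; rewrite ?addr0// -natr1 addrA dcurve_periodic.
case: m => k; first exact: nat_mod.
by rewrite -[in RHS](subrK k.+1%:R t) nat_mod NegzE mulrNz.
Qed.

Lemma dcurve_mod1 (s t : R) : eq_mod1 s t -> dcurve D s = dcurve D t.
Proof. by move=> [m ->]; exact: dcurve_intmod. Qed.

(** The height is continuous and periodic, so its maximum over a period bounds
    it everywhere. *)
Lemma knot_bounded : exists M, forall t, (dcurve D t).2 < M.
Proof.
have [_ _ [dz _]] := dcurve_C1 D.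
have cz : {within `[0, 1], continuous (zcoord (dcurve D))}.
  apply: continuous_subspaceT => t; apply: differentiable_continuous.
  exact/derivable1_diffP.
have [c _ cmax] := EVT_max ler01 cz.
exists (zcoord (dcurve D) c + 1) => t.
rewrite -(dcurve_intmod t (- Num.floor t)) ltr_pwDr//.
apply: cmax; rewrite in_itv/= mulrNz; apply/andP; split.
  by rewrite subr_ge0 floor_le.
by rewrite lerBlDl ltW// -[X in _ + X]/(1%:~R) -intrD floorD1_gt.
Qed.

Lemma knot_arc_exists (i : 'I_(dn D)) : exists s, knot_arc i s.
Proof.
suff ilt : dunder i < dunder (ordS i) + (i.+1 == dn D)%:R.
  exists ((dunder i + (dunder (ordS i) + (i.+1 == dn D)%:R)) / 2), 0.
  by rewrite addr0; lra.
have /andP[u0 u1] := dunder_range i; have /andP[v0 v1] := dunder_range (ordS i).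
case: eqP => [_|/eqP ni]; first by rewrite /=; lra.
have ilt : (i.+1 < dn D)%N by rewrite ltn_neqAle ni ltn_ord.
by rewrite addr0 dunder_mono//= modn_small.
Qed.

(** Arcs are open intervals between consecutive undercrossing times, and there
    is no undercrossing time, modulo 1, strictly between those. *)
Lemma knot_arc_under (i k : 'I_(dn D)) s : knot_arc i s -> ~ eq_mod1 s (dunder k).
Proof.
move=> [m +] [m' se]; rewrite {s}se -addrA -intrD; move: (m' + m) => {m'} {}m.
have /andP[u0 u1] := dunder_range i; have /andP[v0 v1] := dunder_range (ordS i).
have /andP[w0 w1] := dunder_range k.
have mono (a b : 'I_(dn D)) : (a <= b)%N -> dunder a <= dunder b.
  by rewrite leq_eqVlt => /orP[/eqP/val_inj->//|/dunder_mono/ltW].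
have small (z : int) : z%:~R < 1 :> R -> -1 < z%:~R :> R -> z = 0.
  by rewrite -[1]/(1%:~R) -mulrNz !ltr_int; lia.
case: eqP => [ni|/eqP ni] /= /andP[um mv].
  have k0 : dunder (ordS i) <= dunder k by apply: mono; rewrite /= ni modnn.
  have ki : dunder k <= dunder i by apply: mono; rewrite -ltnS ni.
  have m0 : m = 0 by apply: small; lra.
  by move: um; rewrite m0 /=; lra.
have m0 : m = 0 by apply: small; lra.
move: um mv; rewrite m0 !addr0 => um mv.
have ilt : (i.+1 < dn D)%N by rewrite ltn_neqAle ni ltn_ord.
have [ki|ik] := leqP k i; first by have := mono _ _ ki; lra.
by have := mono (ordS i) k; rewrite /= modn_small// => /(_ ik); lra.
Qed.

(** Over a point of the projection with two preimages, the lower one is an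
    undercrossing, which no arc contains. *)
Lemma knot_arc_top (i : 'I_(dn D)) s t : knot_arc i s ->
  (dcurve D t).1 = (dcurve D s).1 -> (dcurve D t).2 <= (dcurve D s).2.
Proof.
move=> si /ddouble[/dcurve_mod1->//|[k [[tk sk]|[_ sk]]]].
  by have [_ /ltW] := dcross k; rewrite (dcurve_mod1 tk) (dcurve_mod1 sk).
by have := knot_arc_under si sk.
Qed.

(** Straight up from w to height M, then horizontally to the vertical axis: the
    two movements take half of the time each. *)
Definition rise (M : R) (w : R * R * R) (t : R) : R * R * R :=
  (Num.min 1 (2 - 2 * t) * w.1.1, Num.min 1 (2 - 2 * t) * w.1.2,
   w.2 + Num.min 1 (2 * t) * (M - w.2)).

Lemma is_path_rise (M : R) (w : R * R * R) : is_path w (0, 0, M) (rise M w).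
Proof.
split; last 2 first.
- rewrite /rise mulr0 subr0 !minElt ltr1n ltr10 mul0r addr0 !mul1r.
  by case: w => -[].
- by rewrite /rise mulr1 subrr !minElt ltr10 ltr1n !mul0r mul1r addrC subrK.
have cmin (f g : R -> R) : continuous f -> continuous g ->
    continuous (fun t => Num.min (f t) (g t)).
  by move=> cf cg t; apply: continuous_min; [exact: cf|exact: cg].
have c1 : continuous (fun _ : R => 1 : R) by move=> t; exact: cvg_cst.
have cup : continuous (fun t : R => 2 * t).
  exact: mulrl_continuous.
have cdown : continuous (fun t : R => 2 - 2 * t).
  by move=> t; apply: cvgB; [exact: cvg_cst|exact: cup].
apply: continuous_subspaceT; rewrite /rise.
apply: continuous_pair; first apply: continuous_pair.
- by move=> t; apply: cvgM; [exact: (cmin _ _ c1 cdown)|exact: cvg_cst].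
- by move=> t; apply: cvgM; [exact: (cmin _ _ c1 cdown)|exact: cvg_cst].
- move=> t; apply: cvgD; first exact: cvg_cst.
  by apply: cvgM; [exact: (cmin _ _ c1 cup)|exact: cvg_cst].
Qed.

(** On the vertical part the knot stays below because w is the top point over its
    projection; on the horizontal part, because M exceeds all heights. *)
Lemma above_rise M (i : 'I_(dn D)) s t : (forall u, (dcurve D u).2 < M) ->
  knot_arc i s -> 0 < t <= 1 -> above D (rise M (dcurve D s) t).
Proof.
move=> MD si /andP[t0 t1] u /=; rewrite !minElt.
have [th|th] := ltP 1 (2 - 2 * t).
  rewrite !mul1r -surjective_pairing => /(knot_arc_top si) us.
  by rewrite ifF; [have := MD s; nra|lra].
move=> _; have [th'|th'] := ltP 1 (2 * t); first by rewrite mul1r addrC subrK.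
have -> : 2 * t = 1 by lra.
by rewrite mul1r addrC subrK.
Qed.

End DiagramCords.

(** * The cord matrix in a character *)

Section CordCharacters.
Variables (R : realType) (K : set (S3 R)) (D : diagram R) (h : R -> S3 R -> S3 R).
Hypothesis hD : isotopy_to_diagram D K h.
Variables (T : topologicalType) (p : T -> S3 R).
Hypothesis hp : double_branched_cover p K.

(** The paths s_i are first pulled back to paths ending at the knot K by the
    inverse of the final homeomorphism of the isotopy. The lifts be_i and al_i
    start at the same point since K has single preimages. *)
Lemma lifted_rises : exists (y1 y2 : T) (s : 'I_(dn D) -> R)
    (M : R) (al be : 'I_(dn D) -> R -> T),
  [/\ y1 <> y2, forall u, (dcurve D u).2 < M, forall i, knot_arc i (s i),
      forall i, is_path (al i 0) y1 (al i) /\ is_path (al i 0) y2 (be i) &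
      forall i t, 0 <= t <= 1 ->
        h 1 (p (al i t)) = Some (rise M (dcurve D (s i)) t) /\
        h 1 (p (be i t)) = Some (rise M (dcurve D (s i)) t)].
Proof.
have [_ _ hom hK] := hD.
have [k [ch ck hk kh]] := hom 1 ltac:(by rewrite ler01 lexx).
have KE x : K x <-> diagram_knot D (h 1 x).
  by rewrite -hK; split=> [Kx|[x' Kx' /(can_inj hk) <-]//]; exists x.
have [M MD] := knot_bounded D.
have [s sP] := choice (@knot_arc_exists R D).
pose q i t : S3 R := k (Some (rise M (dcurve D (s i)) t)).
have cq i : {within `[0, 1], continuous (q i)}.
  have [cr _ _] := is_path_rise M (dcurve D (s i)).
  apply: (@within_comp _ _ _ _ setT (fun v : R * R * R => k (Some v)) _ cr) => //.
  apply: continuous_subspaceT => v W /ck.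
  exact: one_point_compactification_some_continuous.
have q0 i : K (q i 0).
  apply/KE; rewrite /q kh; have [_ -> _] := is_path_rise M (dcurve D (s i)).
  by exists (s i).
have qK i t : 0 < t <= 1 -> ~ K (q i t).
  move=> t01 /KE; rewrite /q kh => -[u _ [ur]].
  by have := above_rise MD (sP i) t01 (congr1 fst ur); rewrite ur ltxx.
have q1 i : q i 1 = k (Some (0, 0, M)).
  by rewrite /q; have [_ _ ->] := is_path_rise M (dcurve D (s i)).
have KP : ~ K (k (Some (0, 0, M))).
  by rewrite -(q1 (Ordinal (dn_gt0 D))); apply: qK; rewrite ltr01 lexx.
have [y1 [y2 [py1 py2 y12]]] := two_preimages hp KP.
have lift y : p y = k (Some (0, 0, M)) -> forall i,
    exists f, is_lift p 0 1 (q i) f /\ f 1 = y.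
  move=> py i; have [||f lf f1] := @lift_branch _ _ _ _ hp (q i) y (cq i) (q0 i).
  - exact: qK.
  - by rewrite q1.
  - by exists f.
have [al alP] := choice (lift _ py1).
have [be beP] := choice (lift _ py2).
exists y1, y2, s, M, al, be; split=> // [i|i t t01].
- have [[ca pa] a1] := alP i; have [[cb pb] b1] := beP i.
  split; split=> //.
  have [z _ zu] := branch_point hp (q0 i).
  have t0 : 0 <= (0 : R) <= 1 by rewrite lexx ler01.
  by rewrite (zu _ (pb 0 t0)); apply/esym/zu/pa.
- have [[_ pa] _] := alP i; have [[_ pb] _] := beP i.
  by rewrite pa// pb// /q kh.
Qed.

Lemma above_cord_rises (M : R) (i j : 'I_(dn D)) s t :
  (forall u, (dcurve D u).2 < M) -> knot_arc i s -> knot_arc j t ->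
  above_cord i j (path_cat (rise M (dcurve D s)) (path_rev (rise M (dcurve D t)))).
Proof.
move=> MD si tj.
have [cc c0 c1] := is_path_cat (is_path_rise M (dcurve D s))
  (is_path_rev (is_path_rise M (dcurve D t))).
split=> //; [by exists s|by exists t|].
move=> r r01; rewrite /path_cat; case: leP => r2.
  by apply: (above_rise MD si); lra.
by rewrite /path_rev; apply: (above_rise MD tj); lra.
Qed.

Variables (x0 : T) (Z : {rmorphism HC0ab_C D -> regular_fun R (pi1 R x0)}).
Hypothesis hZ : cord_trace_map h p Z.

(** The loop al_i al_j^-1 be_j be_i^-1 is X_j X_i^-1 conjugated by al_i. *)
Lemma cord_traces : exists X : 'I_(dn D) -> pi1 R x0, forall i j, exists x,
  forall chi, Z (c_C i j) chi = chi (x * X j * (X i)^-1 * x^-1)%g.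
Proof.
have [_ conn _ _] := hp.
have [e eP] := choice (conn x0).
have [y1 [y2 [s [M [al [be [y12 MD sP pab hab]]]]]]] := lifted_rises.
pose hol := holonomy x0 e.
exists (fun j => ((hol (al j))^-1 * hol (be j))%g) => i j; exists (hol (al i)) => chi.
have [ai bi] := pab i; have [aj bj] := pab j.
pose g1 := path_cat (al i) (path_rev (al j)).
pose g2 := path_cat (be i) (path_rev (be j)).
have p1 : is_path (al i 0) (al j 0) g1 := is_path_cat ai (is_path_rev aj).
have p2 : is_path (al i 0) (al j 0) g2 := is_path_cat bi (is_path_rev bj).
have pd := is_path_cat p1 (is_path_rev p2).
have [_ d0 d1] := pd.
have [_ cordZ] := hZ.
rewrite (cordZ i j _ g1 g2 (hol (path_cat g1 (path_rev g2)))
  (above_cord_rises MD (sP i) (sP j))).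
- rewrite /trace_fun /hol (holonomyM eP p1 (is_path_rev p2)) (holonomyV eP p2).
  rewrite (holonomyM eP ai (is_path_rev aj)) (holonomyM eP bi (is_path_rev bj)).
  rewrite (holonomyV eP aj) (holonomyV eP bj); congr (char_fun chi _).
  by rewrite !invgM !invgK !mulgA mulgK.
- have [c1 _ _] := p1; have [c2 _ _] := p2.
  split; last exists 2^-1; [split=> // t t01|split=> // t t01|lra|].
  + rewrite /g1 /path_cat /path_rev; case: leP => t2.
      by have [|->] := hab i (2 * t); first by lra.
    by have [|->] := hab j (1 - (2 * t - 1)); first by lra.
  + rewrite /g2 /path_cat /path_rev; case: leP => t2.
      by have [|_ ->] := hab i (2 * t); first by lra.
    by have [|_ ->] := hab j (1 - (2 * t - 1)); first by lra.
  + rewrite /g1 /g2 /path_cat lexx divff//.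
    by have [_ _ ->] := ai; have [_ _ ->] := bi.
- exists (e (al i 0)).
  have lP := is_path_based eP pd.
  exists (Loop lP); split=> //=.
  + by rewrite d0; exact: eP.
  + by rewrite /based d0 d1.
  + by rewrite /hol /holonomy (pi1_of_loop (Loop lP)).
Qed.

End CordCharacters.

Theorem proposition5p6 (R : realType)
    (K : set (S3 R)) (D : diagram R) (h : R -> S3 R -> S3 R)
    (hD : isotopy_to_diagram D K h)
    (T : topologicalType) (p : T -> S3 R) (hp : double_branched_cover p K)
    (x0 : T)
    (Z : {rmorphism HC0ab_C D -> regular_fun R (pi1 R x0)})
    (hZ : cord_trace_map h p Z)
    (haug : exists eps : {rmorphism HC0ab D -> R[i]},
      (5 <= augmentation_rank eps)%N) :
  (exists b : HC0ab_C D, b \notin @nilradical (HC0ab_C D) /\ Z b = 0) /\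
  (exists Zred : {rmorphism {ideal_quot (@nilradical (HC0ab_C D))} ->
                            regular_fun R (pi1 R x0)},
    (forall x, Zred (\pi x) = Z x) /\ ~ bijective Zred).
Proof.
have [b [bN Zb]] : exists b : HC0ab_C D, b \notin @nilradical (HC0ab_C D) /\ Z b = 0.
  have [eps /exists_minor_neq0[f [g fg0]]] := haug.
  (* the minor of the generic cord matrix at the rows and columns where eps has
     a nonzero minor *)
  exists (\det (\matrix_(a, b) c_C (f a) (g b))); split; last first.
    have [X XP] := cord_traces hD hp hZ.
    apply: regular_fun_eq0 => chi; have [phi phiE] := regular_fun_rmorphism Z chi.
    rewrite -phiE -det_map_mx.
    apply: (@det_char_eq0 _ _ 5 chi (X \o g) (X \o f)) => // a c.
    by have [x xP] := XP (f a) (g c); exists x; rewrite !mxE phiE xP.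
  have [|i j|i j k l ijk|phi [_ phiE]] := @cord_lift_ex R[i] (dn D) (crossing D)
      R[i] idfun (fun i j => eps (c_int i j)).
  - by move=> i; rewrite /c_int cordii rmorph_nat.
  - by rewrite /c_int cordC.
  - by rewrite /c_int -rmorphD -rmorphM (cord_rel _ _ ijk).
  apply/negP => /asboolP[n /(congr1 phi)]; rewrite rmorphXn rmorph0 -det_map_mx.
  apply/eqP; rewrite expf_neq0//; apply: contra_neq fg0 => <-; congr (\det _).
  by apply/matrixP => a c; rewrite !mxE phiE.
split; first by exists b.
have [Zred ZredE] := ideal_quot_lift (@nilradical_regular_fun _ _ _ Z).
exists Zred; split=> // /bij_inj inj.
move/negP: bN; apply; have : \pi_{ideal_quot (@nilradical (HC0ab_C D))} b = \pi 0.
  by apply: inj; rewrite !ZredE Zb rmorph0.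
by move/eqP; rewrite -Quotient.idealrBE subr0.
Qed.
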